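(* Let $\mathsf X$ be a finite alphabet and let $G\le\mathrm{Aut}(\mathsf X^* )$ be a finitely generated, contracting, self-replicating self-similar group which is regular branch. Then $G$ does not have Property PW.
   Context: $\mathsf X^*$ is the rooted tree of finite words over $\mathsf X$. For $g\in\mathrm{Aut}(\mathsf X^* )$ and $v\in\mathsf X^*$ the section $g|_v\in\mathrm{Aut}(\mathsf X^* )$ is defined by $g(vw)=g(v)\,g|_v(w)$ for all $w$. $G\le\mathrm{Aut}(\mathsf X^* )$ is self-similar if $g|_v\in G$ for all $g\in G$, $v\in \mathsf X^*$. It is self-replicating if it acts transitively on $\mathsf X$ and, for $x\in \mathsf X$, the map $G_x\to G$, $g\mapsto g|_x$ from the stabilizer of $x$ is onto. It is contracting if there is a finite set $\mathcal N\subset G$ such that for every $g\in G$ there is $m$ with $g|_v\in\mathcal N$ for all $|v|\ge m$. $G$ is regular branch if there is a finite-index subgroup $K\le G$ with $K^{\mathsf X}\le K$, where $K^{\mathsf X}$ is the subgroup of $\mathrm{Aut}(\mathsf X^* )$ of elements fixing the first level $\mathsf X$ pointwise and having all sections $g|_x$, $x\in\mathsf X$, in $K$. Property PW: there exist a $G$-set $Y$ and a subset $A\subset Y$ with $gA\triangle A$ finite for all $g\in G$, such that the function $\nu_A(g)=|gA\triangle A|$ is proper, i.e. $\{g\in G:\nu_A(g)\le n\}$ is finite for every $n$.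
   Formalization: The alphabet is assumed to have at least two letters; with at most one letter the trivial group satisfies all the hypotheses and, being finite, has Property PW, so the claim fails there. *)

(* Defs.v *)
From HB Require Import structures.
From mathcomp Require Import all_boot.
From mathcomp Require Import finmap boolp classical_sets functions cardinality.

Set Implicit Arguments.
Unset Strict Implicit.
Unset Printing Implicit Defensive.

Local Open Scope classical_set_scope.
Local Open Scope group_scope.

Section Tree.
Variable X : finType.
Implicit Types (x y : X) (u v w : seq X).

(* Words are the vertices of the rooted tree, with root [::]; v is adjacent to
   vx for every letter x. *)
Definition tree_edge : rel (seq X) :=
  fun v w => [exists x, (w == rcons v x) || (v == rcons w x)].

Record tree_aut := TreeAut {
  aut_fun :> seq X -> seq X;
  aut_bij : bijective aut_fun;
  aut_root : aut_fun [::] = [::];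
  aut_edge : forall v w, tree_edge (aut_fun v) (aut_fun w) = tree_edge v w }.

Lemma tree_aut_ext (g h : tree_aut) : g =1 h -> g = h.
Proof.
case: g h => [g gb gr ge] [h hb hr he] /= /funext gh; rewrite -gh in hb hr he *.
by congr TreeAut; exact: Prop_irrelevance.
Qed.

Lemma tree_edgeP v w :
  reflect (exists x, w = rcons v x \/ v = rcons w x) (tree_edge v w).
Proof.
apply: (iffP existsP) => -[x].
  by case/orP=> /eqP ->; exists x; [left|right].
by case=> ->; exists x; rewrite eqxx ?orbT.
Qed.

Lemma aut_rcons (g : tree_aut) v x : exists y, g (rcons v x) = rcons (g v) y.
Proof.
elim/last_ind: v x => [|v z IH] x.
  have /tree_edgeP[y] : tree_edge (g [::]) (g (rcons [::] x)).
    by rewrite aut_edge; apply/tree_edgeP; exists x; left.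
  by case=> [->|]; [exists y | rewrite aut_root => /(congr1 size); rewrite size_rcons].
have /tree_edgeP[y] : tree_edge (g (rcons v z)) (g (rcons (rcons v z) x)).
  by rewrite aut_edge; apply/tree_edgeP; exists x; left.
case=> [->|]; first by exists y.
have [t ->] := IH z => /rcons_inj[/(bij_inj (aut_bij g))/(congr1 size)].
by rewrite !size_rcons => /eqP; rewrite eqn_leq ltnNge leqnSn andbF.
Qed.

Lemma size_aut (g : tree_aut) v : size (g v) = size v.
Proof.
elim/last_ind: v => [|v x IH]; first by rewrite aut_root.
by have [y ->] := aut_rcons g v x; rewrite !size_rcons IH.
Qed.

Lemma take_aut (g : tree_aut) v w : take (size v) (g (v ++ w)) = g v.
Proof.
elim/last_ind: w => [|w x IH]; first by rewrite cats0 -{1}(size_aut g) take_size.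
rewrite -rcons_cat; have [y ->] := aut_rcons g (v ++ w) x.
by rewrite -cats1 takel_cat // size_aut size_cat leq_addr.
Qed.

Lemma id_aut_edge v w : tree_edge (id v) (id w) = tree_edge v w.
Proof. by []. Qed.

Definition aut_one : tree_aut := TreeAut (inv_bij (frefl _)) erefl id_aut_edge.

Lemma aut_mul_root (g h : tree_aut) : (g \o h) [::] = [::].
Proof. by rewrite /= !aut_root. Qed.

Lemma aut_mul_edge (g h : tree_aut) v w :
  tree_edge ((g \o h) v) ((g \o h) w) = tree_edge v w.
Proof. by rewrite /= !aut_edge. Qed.

Definition aut_mul (g h : tree_aut) : tree_aut :=
  TreeAut (bij_comp (aut_bij g) (aut_bij h)) (aut_mul_root g h)
          (aut_mul_edge g h).

Definition aut_inv_fun (g : tree_aut) v : seq X := xget [::] [set u | g u = v].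

Lemma aut_inv_funK (g : tree_aut) : cancel (aut_inv_fun g) g.
Proof.
move=> v; have [h _ hK] := aut_bij g.
by rewrite /aut_inv_fun; case: xgetP => [u _ //|/(_ (h v))]; rewrite /= hK.
Qed.

Lemma aut_funK (g : tree_aut) : cancel g (aut_inv_fun g).
Proof. by move=> v; apply: (bij_inj (aut_bij g)); rewrite aut_inv_funK. Qed.

Lemma aut_inv_bij (g : tree_aut) : bijective (aut_inv_fun g).
Proof. exact: Bijective (@aut_inv_funK g) (@aut_funK g). Qed.

Lemma aut_inv_root (g : tree_aut) : aut_inv_fun g [::] = [::].
Proof. by rewrite -{1}(aut_root g) aut_funK. Qed.

Lemma aut_inv_edge (g : tree_aut) v w :
  tree_edge (aut_inv_fun g v) (aut_inv_fun g w) = tree_edge v w.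
Proof. by rewrite -(aut_edge g) !aut_inv_funK. Qed.

Definition aut_inv (g : tree_aut) : tree_aut :=
  TreeAut (aut_inv_bij g) (aut_inv_root g) (@aut_inv_edge g).

Lemma aut_mulA : associative aut_mul.
Proof. by move=> g h k; exact: tree_aut_ext. Qed.
Lemma aut_mul1 : left_id aut_one aut_mul.
Proof. by move=> g; exact: tree_aut_ext. Qed.
Lemma aut_mulr1 : right_id aut_one aut_mul.
Proof. by move=> g; exact: tree_aut_ext. Qed.
Lemma aut_mulV : left_inverse aut_one aut_inv aut_mul.
Proof. by move=> g; apply: tree_aut_ext => v /=; rewrite aut_funK. Qed.
Lemma aut_mulrV : right_inverse aut_one aut_inv aut_mul.
Proof. by move=> g; apply: tree_aut_ext => v /=; rewrite aut_inv_funK. Qed.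

(* The product is composition, (g * h) v = g (h v): automorphisms act on words
   from the left. *)
HB.instance Definition _ := gen_eqMixin tree_aut.
HB.instance Definition _ := gen_choiceMixin tree_aut.
HB.instance Definition _ :=
  isGroup.Build tree_aut aut_mulA aut_mul1 aut_mulr1 aut_mulV aut_mulrV.

(* g|_v : as g (v ++ w) has g v as its prefix of length size v, dropping that
   prefix leaves g|_v w; see sectionE. *)
Definition section_fun (g : tree_aut) v w : seq X := drop (size v) (g (v ++ w)).

Lemma section_funE (g : tree_aut) v w : g (v ++ w) = g v ++ section_fun g v w.
Proof. by rewrite -[LHS](cat_take_drop (size v)) take_aut. Qed.

Lemma section_fun_bij (g : tree_aut) v : bijective (section_fun g v).
Proof.
exists (section_fun (aut_inv g) (g v)) => w.
  by rewrite {1}/section_fun -section_funE /= aut_funK size_aut drop_size_cat.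
have vu : v ++ section_fun (aut_inv g) (g v) w = aut_inv g (g v ++ w).
  by rewrite section_funE /= aut_funK.
by rewrite {1}/section_fun vu /= aut_inv_funK -(size_aut g v) drop_size_cat.
Qed.

Lemma section_fun_root (g : tree_aut) v : section_fun g v [::] = [::].
Proof. by rewrite /section_fun cats0 -(size_aut g v) drop_size. Qed.

Lemma tree_edge_cat u v w : tree_edge (u ++ v) (u ++ w) = tree_edge v w.
Proof.
by apply: eq_existsb => x; rewrite !rcons_cat !eqseq_cat // !eqxx.
Qed.

Lemma section_fun_edge (g : tree_aut) v u w :
  tree_edge (section_fun g v u) (section_fun g v w) = tree_edge u w.
Proof. by rewrite -(tree_edge_cat (g v)) -!section_funE aut_edge tree_edge_cat. Qed.

Definition section (g : tree_aut) v : tree_aut :=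
  TreeAut (section_fun_bij g v) (section_fun_root g v) (@section_fun_edge g v).

Lemma sectionE (g : tree_aut) v w : g (v ++ w) = g v ++ section g v w.
Proof. exact: section_funE. Qed.

End Tree.

Section Groups.
Variable T : groupType.
Implicit Types G H K : set T.

Definition subgroup G : Prop := group_closed (mem G).

Definition finitely_generated G : Prop :=
  exists2 S : set T, finite_set S & smallest subgroup S = G.

Definition finite_index G K : Prop :=
  finite_set [set [set g * k | k in K] | g in G].

(* The action is only constrained on elements of G; [act g] is irrelevant for
   g outside G. *)
Definition group_action G (Y : Type) (act : T -> Y -> Y) : Prop :=
  (forall y, act 1 y = y) /\
  (forall g h, G g -> G h -> forall y, act (g * h) y = act g (act h y)).

(* |gA \triangle A|; fset_set returns the empty set on infinite sets, so this is
   meaningful only when the symmetric difference is finite. *)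
Definition nu (Y : Type) (act : T -> Y -> Y) (A : set Y) (g : T) : nat :=
  #|` fset_set ((act g @` A) `+` A : set {classic Y}) |.

Definition property_PW G : Prop :=
  exists (Y : Type) (act : T -> Y -> Y) (A : set Y),
    [/\ group_action G act,
        forall g, G g -> finite_set ((act g @` A) `+` A) &
        forall n : nat, finite_set [set g | G g /\ (nu act A g <= n)%N]].

End Groups.

Section SelfSimilar.
Variable X : finType.
Implicit Types G K : set (tree_aut X).

Definition self_similar G : Prop :=
  forall g v, G g -> G (section g v).

Definition letter_transitive G : Prop :=
  forall x y : X, exists2 g, G g & g [:: x] = [:: y].

Definition self_replicating G : Prop :=
  letter_transitive G /\
  forall (x : X) h, G h ->
    exists g, [/\ G g, g [:: x] = [:: x] & section g [:: x] = h].

Definition contracting G : Prop :=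
  exists N : set (tree_aut X),
    [/\ finite_set N, N `<=` G &
        forall g, G g -> exists m : nat,
          forall v : seq X, (m <= size v)%N -> N (section g v)].

(* K^X *)
Definition first_level_power K : set (tree_aut X) :=
  [set g : tree_aut X | forall x : X, g [:: x] = [:: x] /\ K (section g [:: x])].

Definition regular_branch G : Prop :=
  exists K : set (tree_aut X),
    [/\ subgroup K, K `<=` G, finite_index G K & first_level_power K `<=` K].

End SelfSimilar.

(* Main.v *)
(* The idea: let R_w be the subgroup of G acting only below the vertex w and T_w the
   subgroup acting trivially below w. They commute, and regular branching makes R_w T_w
   of finite index. Suppose A is a subset of a G-set Y with finite errors
   {y | [y in A] differs from [g y in A]}. Elements of R_w have few errors on an orbit
   unless some R_w-orbit is split by A into two infinite parts.

   If T_w has an infinite orbit at a point of such an R_w-orbit, an ends argument for the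
   commuting groups R_w and T_w shows that point stabilizers in R_w are normalized by
   finite-index subgroups, hence contain the commutators of elements of a finite-index
   subgroup of R_w supported below suitable vertices: these have no errors there.

   If instead T_w-orbits are finite at such points for vertices w of every level, Y
   behaves like an orbit of ends of the tree: each point y determines a ray of vertices w,
   and T_w y is a block of bounded size. For fixed k, contraction lets one connect y to its
   image under the copy k_w of k below w by a path along which only finitely many sections
   at w occur, independently of w. Such a path meets a given error of a generator for
   boundedly many y, so k_w has boundedly many errors as w varies.

   Commutators of elements supported below two vertices of large level combine both cases
   and give infinitely many elements of G on which nu_A is bounded. *)
Require Import Defs.
From mathcomp Require Import all_boot.
From mathcomp Require Import finmap boolp classical_sets functions cardinality.

Set Implicit Arguments.
Unset Strict Implicit.
Unset Printing Implicit Defensive.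

(** * Finite sets and injections *)

Section FiniteSets.
Local Open Scope classical_set_scope.

Lemma finite_set_inj (T U : Type) (A : set T) (B : set U) (f : T -> U) :
  (forall x y, A x -> A y -> f x = f y -> x = y) -> (forall x, A x -> B (f x)) ->
  finite_set B -> finite_set A.
Proof.
move=> injf fB finB.
have [[a0 a0A]|nA] := pselect (exists a, A a); last first.
  by apply: (sub_finite_set (B := set0)) => // a aA; case: nA; exists a.
have /choice[g gP] : forall b, exists a, forall a', A a' -> f a' = b -> a = a'.
  move=> b; have [[a [aA ab]]|na] := pselect (exists a, A a /\ f a = b).
    by exists a => a' a'A a'b; apply: injf; rewrite ?a'b.
  by exists a0 => a' a'A a'b; case: na; exists a'.
by apply: (sub_finite_set (B := g @` B)); [move=> a aA; exists (f a);
  [exact: fB|exact: gP]|exact: finite_image].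
Qed.

End FiniteSets.

(** * Finite generation and finite index *)

Section Generation.
Local Open Scope group_scope.
Local Open Scope classical_set_scope.
Variable T : groupType.
Implicit Types (G H K U V : set T) (S c : seq T) (g h : T).

Lemma subgroupP G : G 1 -> (forall g h, G g -> G h -> G (g * h)) ->
  (forall g, G g -> G g^-1) -> subgroup G.
Proof.
move=> G1 GM GV; split; first by apply/mem_set.
by move=> g h /set_mem gG /set_mem hG; apply/mem_set/GM => //; apply: GV.
Qed.

Lemma subgroup1 G : subgroup G -> G 1.
Proof. by move=> [/set_mem]. Qed.

Lemma subgroupM G g h : subgroup G -> G g -> G h -> G (g * h).
Proof.
by move=> /group_closedM + gG hG => /(_ g h); rewrite !inE; apply.
Qed.

Lemma subgroupV G g : subgroup G -> G g -> G g^-1.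
Proof. by move=> /group_closedV + gG => /(_ g); rewrite !inE; apply. Qed.

Definition wprod c : T := foldr *%g 1 c.

Lemma wprod_cat c c' : wprod (c ++ c') = wprod c * wprod c'.
Proof. by elim: c => [|s c IH] /=; rewrite ?mul1g // IH mulgA. Qed.

Lemma subgroup_wprod G c : subgroup G -> (forall s, s \in c -> G s) -> G (wprod c).
Proof.
move=> sG; elim: c => [|s c IH] cG /=; first exact: subgroup1.
apply: subgroupM => //; first by apply: cG; rewrite mem_head.
by apply: IH => t tc; apply: cG; rewrite inE tc orbT.
Qed.

(* Generation as a monoid, so that no inverses occur in words. *)
Definition generates S G :=
  (forall s, s \in S -> G s) /\
  (forall g, G g -> exists2 c, {subset c <= S} & wprod c = g).

Lemma finitely_generated_generates G :
  finitely_generated G -> exists S, generates S G.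
Proof.
move=> [A /finite_seqP[s ->] <-].
pose S := s ++ [seq x^-1 | x <- s].
have SV x : x \in S -> x^-1 \in S.
  rewrite !mem_cat => /orP[xs|/mapP[y ys ->]]; last by rewrite invgK ys.
  by rewrite map_f ?orbT.
exists S; split=> [x|g].
  rewrite mem_cat => xS M [sM AM]; move: xS => /orP[xs|/mapP[y ys ->]].
    exact: AM.
  by apply: subgroupV => //; apply: AM.
move=> /(_ [set g | exists2 c, {subset c <= S} & wprod c = g]); apply; split.
  apply: subgroupP; first by exists [::].
    move=> x y [c cS <-] [c' cS' <-]; exists (c ++ c'); last exact: wprod_cat.
    by move=> z; rewrite mem_cat => /orP[/cS|/cS'].
  move=> _ [c cS <-]; elim: c cS => [|x c IH] cS; first by exists [::]; rewrite ?invg1.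
  have [d dS dE] : exists2 d, {subset d <= S} & wprod d = (wprod c)^-1.
    by apply: IH => z zc; apply: cS; rewrite inE zc orbT.
  exists (d ++ [:: x^-1]).
    move=> z; rewrite mem_cat inE => /orP[/dS//|/eqP->].
    by apply/SV/cS; rewrite mem_head.
  by rewrite wprod_cat dE /= mulg1 invgM.
move=> x xs; exists [:: x]; last by rewrite /= mulg1.
by move=> z; rewrite inE => /eqP ->; rewrite mem_cat xs.
Qed.

(* K need not be contained in G: this says that G meets finitely many left
   cosets of K. *)
Definition coset_finite G K := exists (I : finType) (f : T -> I),
  forall g h, G g -> G h -> f g = f h -> K (g^-1 * h).

Lemma coset_finite_seq (U : eqType) (s : seq U) (f : T -> U) G K :
  (forall g, G g -> f g \in s) ->
  (forall g h, G g -> G h -> f g = f h -> K (g^-1 * h)) -> coset_finite G K.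
Proof.
move=> fs fP; exists 'I_(size s).+1, (fun g => inord (index (f g) s)) => g h gG hG.
move=> /(congr1 val); rewrite /= !inordK ?ltnS ?index_size // => e.
by apply: fP => //; rewrite -(nth_index (f g) (fs g gG)) e nth_index ?fs.
Qed.

Lemma coset_finiteW G G' K K' : G' `<=` G -> (forall g, G' g -> K g -> K' g) ->
  subgroup G' -> coset_finite G K -> coset_finite G' K'.
Proof.
move=> G'G KK' sG' [I [f fP]]; exists I, f => g h gG hG fgh.
by apply: KK'; [apply: subgroupM => //; apply: subgroupV|apply: fP => //; apply: G'G].
Qed.

Lemma finite_index_coset_finite G K : subgroup K -> finite_index G K ->
  coset_finite G K.
Proof.
move=> sK /finite_seqP[s sE].
apply: (@coset_finite_seq _ s (fun g => [set g * k | k in K])) => [g gG|g h gG hG /= e].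
  by have : [set` s] [set g * k | k in K] by rewrite -sE; exists g.
have : [set h * k | k in K] h by exists 1; [exact: subgroup1|rewrite mulg1].
by rewrite -e => -[k kK <-]; rewrite mulKg.
Qed.

Lemma coset_finiteI G K K' :
  coset_finite G K -> coset_finite G K' -> coset_finite G (K `&` K').
Proof.
move=> [I [f fP]] [J [f' fP']]; exists (I * J)%type, (fun g => (f g, f' g)) => g h gG hG.
by case=> e e'; split; [apply: fP|apply: fP'].
Qed.

Lemma coset_finite_nontrivial G K : subgroup G -> infinite_set G ->
  coset_finite G K -> exists g, [/\ G g, K g & g <> 1].
Proof.
move=> sG infG [I [f fP]]; apply: contrapT => nex; apply: infG.
apply: (finite_set_inj (f := f) (B := setT)) => //.
move=> g h gG hG e; apply: contrapT => ngh; apply: nex.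
exists (g^-1 * h); split; [|exact: fP|].
  by apply: subgroupM => //; apply: subgroupV.
by move=> /(congr1 (fun x => g * x)); rewrite mulVKg mulg1 => /esym.
Qed.

Lemma coset_finite_reps G K : coset_finite G K ->
  exists L : seq T, (forall r, r \in L -> G r) /\
    forall g, G g -> exists2 r, r \in L & K (r^-1 * g).
Proof.
move=> [I [f fP]].
have [L LP] : exists L : seq T, (forall r, r \in L -> G r) /\
    forall g, G g -> f g \in enum I -> exists2 r, r \in L & f r = f g.
  elim: (enum I) => [|i s [L [LG LP]]]; first by exists [::].
  have [[r rG fr]|nr] := pselect (exists2 r, G r & f r = i).
    exists (r :: L); split=> [x|g gG]; rewrite inE; first by case/orP=> [/eqP->|/LG].
    case/orP=> [/eqP e|/(LP _ gG)[x xL xe]]; first by exists r; rewrite ?mem_head ?fr.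
    by exists x; rewrite // inE xL orbT.
  exists L; split=> // g gG; rewrite inE => /orP[/eqP e|]; last exact: LP.
  by case: nr; exists g.
case: LP => LG LP; exists L; split=> // g gG.
by have [|r rL fr] := LP g gG; rewrite ?mem_enum //; exists r => //; apply: fP => //; apply: LG.
Qed.

(* Schreier's lemma *)
Lemma generates_coset_finite S G H : subgroup G -> subgroup H -> H `<=` G ->
  coset_finite G H -> generates S G -> exists S', generates S' H.
Proof.
move=> sG sH HG cf [SG gS]; have [L0 [L0G L0P]] := coset_finite_reps cf.
pose L := 1 :: L0.
have LG r : r \in L -> G r by rewrite inE => /orP[/eqP->|/L0G//]; apply: subgroup1.
(* Besides the Schreier generators, the members of [L] in [H] are needed: the word found below
   yields [r^-1 * g] with [r] in [L], and then [r] itself lies in [H]. *)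
pose U := [seq x <- [seq r^-1 * s | r <- L, s <- [seq s * r' | s <- S, r' <- L]] ++ L | `[< H x >]].
have U_closed c : {subset c <= S} ->
    exists2 r, r \in L & exists2 d, {subset d <= U} & wprod d = r^-1 * wprod c.
  elim: c => [|s c IH] cS; first by exists 1; rewrite ?mem_head //; exists [::];
    rewrite //= invg1 mulg1.
  have [|r' r'L [d dU dE]] := IH; first by move=> z zc; apply: cS; rewrite inE zc orbT.
  have sS : s \in S by apply: cS; rewrite mem_head.
  have [r rL rH] := L0P (s * r') (subgroupM sG (SG _ sS) (LG _ r'L)).
  have rL' : r \in L by rewrite inE rL orbT.
  exists r => //; exists (r^-1 * (s * r') :: d) => [z|].
    rewrite inE => /orP[/eqP->|/dU//]; rewrite mem_filter mem_cat; apply/andP; split.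
      exact/asboolP.
    by apply/orP; left; apply: allpairs_f => //; apply: allpairs_f.
  by rewrite /= dE /= -!mulgA mulVKg.
exists U; split=> [x|g gH]; first by rewrite mem_filter => /andP[/asboolP].
have [c cS cE] := gS g (HG _ gH).
have [r rL [d dU dE]] := U_closed c cS.
exists (r :: d); last by rewrite /= dE mulVKg.
have dH : H (wprod d).
  by apply: subgroup_wprod => // s /dU; rewrite mem_filter => /andP[/asboolP].
move=> z; rewrite inE => /orP[/eqP->|/dU//]; rewrite mem_filter mem_cat rL orbT andbT.
apply/asboolP; have -> : r = g * (wprod d)^-1 by rewrite dE cE invgM invgK mulVKg.
by apply: subgroupM => //; apply: subgroupV.
Qed.

Lemma subgroup_commuting_product U V : subgroup U -> subgroup V ->
  (forall u v, U u -> V v -> u * v = v * u) ->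
  subgroup [set g | exists u v, [/\ U u, V v & g = u * v]].
Proof.
move=> sU sV cUV; apply: subgroupP.
- by exists 1, 1; split; rewrite ?mulg1 //; exact: subgroup1.
- move=> _ _ [u [v [uU vV ->]]] [u' [v' [u'U v'V ->]]].
  exists (u * u'), (v * v'); split; [exact: subgroupM|exact: subgroupM|].
  by rewrite -!mulgA; congr (_ * _); rewrite !mulgA (cUV u').
- move=> _ [u [v [uU vV ->]]]; exists u^-1, v^-1; split; [exact: subgroupV|exact: subgroupV|].
  by rewrite invgM (cUV u^-1) //; exact: subgroupV.
Qed.

(** The product of [U] and [V] is finitely generated by Schreier's lemma. As the factors commute and
    meet trivially, the [V]-components of its generators generate [V]. *)
Lemma generates_commuting_factor S G U V : subgroup G -> subgroup U -> subgroup V ->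
  U `<=` G -> V `<=` G -> (forall u v, U u -> V v -> u * v = v * u) ->
  (forall g, U g -> V g -> g = 1) ->
  coset_finite G [set g | exists u v, [/\ U u, V v & g = u * v]] ->
  generates S G -> exists S', generates S' V.
Proof.
move=> sG sU sV UG VG cUV UV1 cf SG.
have [|S' [S'UV gS']] := generates_coset_finite sG (subgroup_commuting_product sU sV cUV) _ cf SG.
  by move=> _ [u [v [/UG uG /VG vG ->]]]; exact: subgroupM.
have /choice[f fP] : forall s, exists v, s \in S' -> V v /\ exists2 u, U u & s = u * v.
  move=> s; have [sS|] := boolP (s \in S'); last by exists 1.
  by have [u [v [uU vV sE]]] := S'UV s sS; exists v => _; split=> //; exists u.
exists (map f S'); split=> [_ /mapP[s /fP[? _] ->]//|g gV].
have [|c cS cE] := gS' g; first by exists 1, g; rewrite mul1g; split=> //; apply: subgroup1.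
exists (map f c); first by move=> _ /mapP[s /cS sS ->]; apply: map_f.
have [fcV [u uU uE]] : V (wprod (map f c)) /\ exists2 u, U u & wprod c = u * wprod (map f c).
  elim: c cS {cE} => [|s c IH] cS /=; first by split; [exact: subgroup1|exists 1;
    rewrite ?mulg1 //; apply: subgroup1].
  have [|fcV [u uU uE]] := IH; first by move=> z zc; apply: cS; rewrite inE zc orbT.
  have [|fsV [u' u'U sE]] := fP s; first by apply: cS; rewrite mem_head.
  split; first exact: subgroupM.
  exists (u' * u); first exact: subgroupM.
  by rewrite {1}sE uE -!mulgA; congr (_ * _); rewrite !mulgA (cUV u).
have u1 : u = 1.
  apply: UV1 => //; have -> : u = g * (wprod (map f c))^-1 by rewrite -cE uE mulgK.
  by apply: subgroupM => //; apply: subgroupV.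
by rewrite -cE uE u1 mul1g.
Qed.

End Generation.

(** * Almost invariant sets and their errors *)

Section Commensuration.
Local Open Scope group_scope.
Local Open Scope classical_set_scope.
Variables (T : groupType) (Y : choiceType).
Variables (G : set T) (act : T -> Y -> Y) (A : set Y).
Hypothesis sG : subgroup G.
Hypothesis actG : group_action G act.
Implicit Types (P Q K : set T) (S c : seq T) (g h p q : T) (x y z : Y).

Lemma act1 y : act 1 y = y.
Proof. exact: actG.1. Qed.

Lemma actM g h y : G g -> G h -> act (g * h) y = act g (act h y).
Proof. by move=> gG hG; apply: actG.2. Qed.

Lemma actK g y : G g -> act g^-1 (act g y) = y.
Proof. by move=> gG; rewrite -actM ?mulVg ?act1 //; exact: subgroupV. Qed.

Lemma actKV g y : G g -> act g (act g^-1 y) = y.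
Proof. by move=> gG; rewrite -actM ?mulgV ?act1 //; exact: subgroupV. Qed.

Lemma act_inj g y z : G g -> act g y = act g z -> y = z.
Proof. by move=> gG /(congr1 (act g^-1)); rewrite !actK. Qed.

Definition orb P y : set Y := [set act p y | p in P].

Lemma orb_refl P y : subgroup P -> orb P y y.
Proof. by move=> sP; exists 1; [exact: subgroup1|rewrite act1]. Qed.

Lemma orb_sym P y z : subgroup P -> P `<=` G -> orb P y z -> orb P z y.
Proof.
by move=> sP PG [p pP <-]; exists p^-1; [exact: subgroupV|rewrite actK //; exact: PG].
Qed.

Lemma orb_trans P x y z : subgroup P -> P `<=` G -> orb P x y -> orb P y z -> orb P x z.
Proof.
move=> sP PG [p pP <-] [q qP <-]; exists (q * p); first exact: subgroupM.
by rewrite actM //; apply: PG.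
Qed.

Lemma orbS P Q y : P `<=` Q -> orb P y `<=` orb Q y.
Proof. by move=> PQ _ [p /PQ pQ <-]; exists p. Qed.

Lemma orb_eq P y z : subgroup P -> P `<=` G -> orb P y z -> orb P z = orb P y.
Proof.
move=> sP PG yz; apply/seteqP; split=> x; apply: orb_trans => //.
exact: orb_sym.
Qed.

(** For [g] in [G], [act g] carries this set onto the symmetric difference counted by [nu]. *)
Definition err g : set Y := [set y | A (act g y) <> A y].

Hypothesis err_finite : forall g, G g -> finite_set (err g).

Definition errs S : set Y := \bigcup_(s in [set` S]) err s.

Lemma errs_finite S : {subset S <= G} -> finite_set (errs S).
Proof.
by move=> SG; apply: bigcup_finite => [|s /SG]; [exact: finite_seq|rewrite inE; exact: err_finite].
Qed.

Lemma err_mul g h y : G g -> G h -> err (g * h) y -> err h y \/ err g (act h y).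
Proof.
move=> gG hG; rewrite /err /= actM // => ne.
have [e|] := pselect (A (act h y) = A y); last by left.
by right; rewrite e.
Qed.

(** The letters of [c], applied from the right, move [y] along a path whose ends are separated by
    [A], so some step crosses the boundary of [A]. *)
Lemma err_wprod c y : (forall s, s \in c -> G s) -> err (wprod c) y ->
  exists c1 s c2, c = c1 ++ s :: c2 /\ err s (act (wprod c2) y).
Proof.
elim: c => [|s c IH] cG; first by rewrite /err /= act1.
have cG' t : t \in c -> G t by move=> tc; apply: cG; rewrite inE tc orbT.
case/err_mul => [||/(IH cG')[c1 [t [c2 [-> e]]]]|e].
- by apply: cG; rewrite mem_head.
- exact: subgroup_wprod.
- by exists (s :: c1), t, c2.
- by exists [::], s, c.
Qed.

(** This confines the errors of all of [P] to the orbits through the errors of the generators. *)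
Lemma generates_err S P p y : subgroup P -> P `<=` G -> generates S P -> P p ->
  err p y -> exists2 e, orb P y e & errs S e.
Proof.
move=> sP PG [SP PS] pP; have [c cS <-] := PS p pP.
move=> /err_wprod[s /cS/SP/PG//|c1 [s [c2 [cE sE]]]].
have c2S : {subset c2 <= S}.
  by move=> t tc; apply: cS; rewrite cE mem_cat inE tc !orbT.
exists (act (wprod c2) y); last by exists s => //=; apply: cS; rewrite cE mem_cat mem_head orbT.
by exists (wprod c2) => //; apply: subgroup_wprod => // t /c2S/SP.
Qed.

Definition mixed P y := exists2 p, P p & err p y.

(** A mixed orbit passes through one of the finitely many errors of generators. *)
Lemma mixed_finite S P : subgroup P -> P `<=` G -> generates S P ->
  finite_set [set y | finite_set (orb P y) /\ mixed P y].
Proof.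
move=> sP PG PS; have SG : {subset S <= G} by move=> s /PS.1/PG; rewrite inE.
apply: (sub_finite_set (B := \bigcup_(e in [set e | errs S e /\ finite_set (orb P e)]) orb P e)).
  move=> y [fin [p pP py]]; have [e ye eE] := generates_err sP PG PS pP py.
  exists e; last exact: orb_sym.
  by split=> //; rewrite (orb_eq _ _ ye).
apply: bigcup_finite => [|e []//]; apply: sub_finite_set (errs_finite SG).
by move=> e [].
Qed.

(** With coset representatives [r], each point of the [P]-orbit is the image under [r] of a point of
    the [K]-orbit. If the image lies in [A], so does that point, unless it is an error of [r]. *)
Lemma coset_finite_infinite P K y : P `<=` G -> subgroup P -> coset_finite P K ->
  infinite_set (orb P y `&` A) -> infinite_set (orb K y `&` A).
Proof.
move=> PG sP /coset_finite_reps[L [LP LK]] inf fin; apply: inf.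
apply: (sub_finite_set (B := \bigcup_(r in [set` L])
    (act r @` (orb K y `&` A) `|` act r @` err r))).
  move=> _ [[g gP <-] gA]; have [r rL rgK] := LK g gP; exists r => //.
  have rP := LP r rL.
  have rgG : G (r^-1 * g) by apply: subgroupM; [|apply: subgroupV|]; auto.
  have yE : act g y = act r (act (r^-1 * g) y) by rewrite -actM ?mulVKg //; exact: PG.
  have [a|na] := pselect (A (act (r^-1 * g) y)).
    by left; exists (act (r^-1 * g) y) => //; split=> //; exists (r^-1 * g).
  right; exists (act (r^-1 * g) y) => //; rewrite /err /= -yE => e.
  by apply: na; rewrite -e.
apply: bigcup_finite => [|r /LP rP]; first exact: finite_seq.
by rewrite finite_setU; split; apply: finite_image => //; apply/err_finite/PG.
Qed.

Lemma orb_shift_finite Q g y : G g -> Q `<=` G -> (forall q, Q q -> g * q = q * g) ->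
  orb Q y `<=` A -> finite_set (orb Q (act g y) `\` A).
Proof.
move=> gG QG gQ yA; apply: (sub_finite_set (B := act g @` err g)).
  move=> _ [[q qQ <-] nA]; exists (act q y); last by rewrite -!actM ?gQ //; exact: QG.
  rewrite /err /= -actM ?gQ ?actM //; try exact: QG.
  by move=> e; apply: nA; rewrite e; apply: yA; exists q.
exact/finite_image/err_finite.
Qed.

(** By [orb_shift_finite] each of these [Q]-orbits lies in [A] up to finitely many points. One
    without errors of generators lies wholly inside or outside [A], hence inside, as it is infinite;
    only finitely many contain such errors. *)
Lemma product_orbit_cofinite S P Q y p0 : subgroup P -> subgroup Q -> P `<=` G ->
  Q `<=` G -> (forall p q, P p -> Q q -> p * q = q * p) -> generates S Q ->
  infinite_set (orb Q y) -> P p0 -> orb Q (act p0 y) `<=` A ->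
  finite_set ((\bigcup_(p in P) orb Q (act p y)) `\` A).
Proof.
move=> sP sQ PG QG PQ SQ infQ p0P p0A.
have shift p : P p -> finite_set (orb Q (act p y) `\` A).
  move=> pP; have -> : act p y = act (p * p0^-1) (act p0 y).
    by rewrite -actM ?mulgVK //; apply: PG => //; apply: subgroupM => //; exact: subgroupV.
  have ppP : P (p * p0^-1) by apply: subgroupM => //; exact: subgroupV.
  by apply: orb_shift_finite => // [|q qQ]; [exact: PG|exact: PQ].
have SG : {subset S <= G} by move=> s /SQ.1/QG; rewrite inE.
apply: (sub_finite_set (B := \bigcup_(e in [set e | errs S e /\
    exists2 p, P p & orb Q (act p y) e]) (orb Q e `\` A))); last first.
  apply: bigcup_finite; first by apply: sub_finite_set (errs_finite SG); move=> e [].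
  by move=> e [_ [p pP pe]]; rewrite (orb_eq _ _ pe) //; exact: shift.
move=> z [[p pP pz] nA].
have [[e [eE pe]]|noe] := pselect (exists e, errs S e /\ orb Q (act p y) e).
  exists e; first by split=> //; exists p.
  by split=> //; rewrite (orb_eq _ _ pe).
suff sub : orb Q (act p y) `<=` orb Q (act p y) `\` A.
  case: infQ; apply: (finite_set_inj (f := act p) (B := orb Q (act p y))).
  - by move=> x x' _ _; apply: act_inj; exact: PG.
  - move=> _ [q qQ <-]; exists q => //.
    by rewrite -!actM ?(PQ p q) //; auto.
  - exact: sub_finite_set (shift _ pP).
move=> x px; split=> // Ax; case: noe.
have [q qQ qx] : orb Q x z by apply: orb_trans pz => //; exact: orb_sym.
have [|e xe eE] := @generates_err S Q q x sQ QG SQ qQ.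
  by rewrite /err /= qx => AA; apply: nA; rewrite AA.
by exists e; split=> //; apply: orb_trans xe.
Qed.

End Commensuration.

(** * Orbits of two commuting groups *)

Section ProductOrbits.
Local Open Scope group_scope.
Local Open Scope classical_set_scope.
Variables (T : groupType) (Y : choiceType).
Variables (G : set T) (act : T -> Y -> Y) (A : set Y).
Hypothesis sG : subgroup G.
Hypothesis actG : group_action G act.
Hypothesis err_finite : forall g, G g -> finite_set (err act A g).

Definition split_by (B O : set Y) := infinite_set (O `&` B) /\ infinite_set (O `\` B).

Lemma err_setC g : err act (~` A) g = err act A g.
Proof.
apply/seteqP; split=> y; rewrite /err /= => ne e; apply: ne; rewrite /setC /=.
  by rewrite e.
by rewrite -[A _]notK e notK.
Qed.

Lemma split_by_coset_finite P K y : P `<=` G -> subgroup P -> coset_finite P K ->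
  split_by A (orb act P y) -> split_by A (orb act K y).
Proof.
move=> PG sP cPK [i1 i2].
split; first exact: (coset_finite_infinite sG actG err_finite PG sP cPK i1).
apply: (@coset_finite_infinite _ _ G act (~` A) sG actG _ P) => // g gG.
by rewrite err_setC; exact: err_finite.
Qed.

(* For commuting groups P and Q, almost invariant sets split an orbit of PQ with
   infinite Q-orbits only if it consists of finitely many Q-orbits: otherwise some
   Q-orbit lies in A or in its complement, and so do all others up to finitely many
   points. *)
Lemma split_product_orbit S P Q y : subgroup P -> subgroup Q -> P `<=` G ->
  Q `<=` G -> (forall p q, P p -> Q q -> p * q = q * p) -> generates S Q ->
  infinite_set (orb act Q y) ->
  split_by A (\bigcup_(p in P) orb act Q (act p y)) ->
  coset_finite P [set p | orb act Q y (act p y)].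
Proof.
move=> sP sQ PG QG PQ SQ infQ [inf1 inf2].
have SG : {subset S <= G} by move=> s /SQ.1/QG; rewrite inE.
(* Without errors of generators [A] would be constant on this [Q]-orbit, and
   [product_orbit_cofinite] would leave only finitely many points on the other side. *)
have meets p : P p -> exists e, errs act A S e /\ orb act Q (act p y) e.
  move=> pP; apply: contrapT => noe.
  have const x : orb act Q (act p y) x -> A x = A (act p y).
    move=> [q qQ <-]; apply: contrapT => ne; apply: noe.
    by have [e] := @generates_err _ _ G act A sG actG S Q q (act p y) sQ QG SQ qQ ne; exists e.
  have [a|na] := pselect (A (act p y)).
    apply: inf2; apply: (@product_orbit_cofinite _ _ G act A sG actG _ S P Q y p) => //.
    by move=> x /const ->.
  apply: inf1; rewrite -[A]setCK.
  apply: (@product_orbit_cofinite _ _ G act (~` A) sG actG _ S P Q y p) => //.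
    by move=> g gG; rewrite err_setC; exact: err_finite.
  by move=> x /const e; rewrite /setC /= e.
have /finite_seqP[sE sEP] := errs_finite err_finite SG.
have /choice[f fP] : forall p, exists e, P p -> e \in sE /\ orb act Q (act p y) e.
  move=> p; have [pP|] := pselect (P p); last by exists y.
  have [e [eE pe]] := meets p pP; exists e => _; split=> //.
  by move: eE; rewrite sEP.
apply: (@coset_finite_seq _ _ sE f) => [g /fP[]//|g h gP hP e].
have [_ [q qQ qE]] := fP g gP; have [_ [q' q'Q q'E]] := fP h hP.
rewrite -e -qE in q'E.
have q'V := subgroupV sQ q'Q.
exists (q'^-1 * q); first exact: subgroupM.
have gG := PG _ gP; have hG := PG _ hP.
have gVG := subgroupV sG gG.
have qqQ : Q (q'^-1 * q) by exact: subgroupM.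
have qqG := QG _ qqQ.
have hE : act h y = act (q'^-1 * q) (act g y).
  by rewrite (actM actG _ (QG _ q'V) (QG _ qQ)) -q'E (actK sG actG) //; exact: QG.
rewrite (actM actG _ gVG hG) hE -(actM actG _ qqG gG) -PQ //.
by rewrite (actM actG _ gG qqG) (actK sG actG).
Qed.

End ProductOrbits.

(** * Tree automorphisms, sections and rigid stabilizers *)

Section TreeAutomorphisms.
Local Open Scope group_scope.
Local Open Scope classical_set_scope.
Variable X : finType.
Local Notation aut := (tree_aut X).
Implicit Types (g h k : aut) (u v w : seq X) (x y : X) (G K : set aut).

Lemma autM g h u : (g * h) u = g (h u).
Proof. by []. Qed.

Lemma aut_VK g : cancel (g^-1)%g g.
Proof. exact: aut_inv_funK. Qed.

Lemma aut_KV g : cancel g (g^-1)%g.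
Proof. exact: aut_funK. Qed.

Lemma aut_inj g : injective g.
Proof. exact: can_inj (aut_KV g). Qed.

Lemma catI v : injective (cat v).
Proof. by move=> u w /eqP; rewrite eqseq_cat // eqxx => /eqP. Qed.

Lemma section1 v : section (1 : aut) v = 1.
Proof.
by apply: tree_aut_ext => u; apply: (@catI v); rewrite -[v in LHS]/((1 : aut) v) -sectionE.
Qed.

Lemma sectionM g h v : section (g * h) v = section g (h v) * section h v.
Proof.
apply: tree_aut_ext => u; have := sectionE (g * h) v u.
by rewrite autM !sectionE => /catI <-.
Qed.

Lemma section_cat g v u : section g (v ++ u) = section (section g v) u.
Proof.
apply: tree_aut_ext => w; have := sectionE g (v ++ u) w.
rewrite -catA sectionE (sectionE (section g v)) (sectionE g v u) -catA.
by move=> /catI/catI.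
Qed.

Lemma sectionV g v : section g^-1 (g v) = (section g v)^-1.
Proof.
by apply: (mulIg (section g v)); rewrite mulVg -sectionM mulVg section1.
Qed.

Lemma section_fix g v : g v = v -> (forall u, g (v ++ u) = v ++ u) <-> section g v = 1.
Proof.
move=> gv; split=> [gu|g1 u]; last by rewrite sectionE gv g1.
apply: tree_aut_ext => u; have := gu u.
by rewrite sectionE gv => /catI.
Qed.

Lemma take_aut_size n g u : take n (g u) = g (take n u).
Proof.
have [un|nu] := leqP (size u) n; first by rewrite !take_oversize ?size_aut.
by rewrite -{1}(cat_take_drop n u) -{1}(size_takel (ltnW nu)) take_aut.
Qed.

Lemma prefix_aut g v u : prefix (g v) (g u) = prefix v u.
Proof. by rewrite !prefixE size_aut take_aut_size (inj_eq (@aut_inj g)). Qed.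

(** The underlying map of [delta w k], the copy [k_w] of [k] below [w]. *)
Definition delta_fun w k u := if prefix w u then w ++ k (drop (size w) u) else u.

Lemma delta_fun_cat w k u : delta_fun w k (w ++ u) = w ++ k u.
Proof. by rewrite /delta_fun prefix_prefix drop_size_cat. Qed.

Lemma delta_funK w k : cancel (delta_fun w k) (delta_fun w k^-1).
Proof.
move=> u; have [/prefixP[v ->]|wu] := boolP (prefix w u).
  by rewrite !delta_fun_cat aut_KV.
by rewrite {2}/delta_fun (negbTE wu) /delta_fun (negbTE wu).
Qed.

Lemma delta_bij w k : bijective (delta_fun w k).
Proof.
exists (delta_fun w k^-1); first exact: delta_funK.
by have := @delta_funK w k^-1; rewrite invgK.
Qed.

Lemma delta_root w k : delta_fun w k [::] = [::].
Proof. by rewrite /delta_fun prefixs0; case: eqP => // ->; rewrite aut_root. Qed.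

Lemma delta_rcons w k v x : exists y, delta_fun w k (rcons v x) = rcons (delta_fun w k v) y.
Proof.
have [/prefixP[u ->]|wv] := boolP (prefix w v).
  have [y ky] := aut_rcons k u x; exists y.
  by rewrite rcons_cat !delta_fun_cat ky rcons_cat.
rewrite {2}/delta_fun (negbTE wv); exists x.
rewrite /delta_fun; case: ifP => // wx; suff -> : w = rcons v x.
  by rewrite drop_size aut_root cats0.
case/prefixP: wx => u; case/lastP: u => [|u z]; first by rewrite cats0.
rewrite -rcons_cat => /rcons_inj[e _].
by move: wv; rewrite e prefix_prefix.
Qed.

Lemma delta_edge w k v u :
  tree_edge (delta_fun w k v) (delta_fun w k u) = tree_edge v u.
Proof.
have imp k' v' u' : tree_edge v' u' -> tree_edge (delta_fun w k' v') (delta_fun w k' u').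
  move=> /tree_edgeP[x [->|->]]; apply/tree_edgeP.
    by have [y ->] := delta_rcons w k' v' x; exists y; left.
  by have [y ->] := delta_rcons w k' u' x; exists y; right.
by apply/idP/idP => [/(imp (k^-1)%g)|/(imp k)//]; rewrite !delta_funK.
Qed.

Definition delta w k : aut := TreeAut (delta_bij w k) (delta_root w k) (@delta_edge w k).

Lemma delta_cat w k u : delta w k (w ++ u) = w ++ k u.
Proof. exact: delta_fun_cat. Qed.

Lemma delta_out w k u : ~~ prefix w u -> delta w k u = u.
Proof. by move=> wu; rewrite /= /delta_fun (negbTE wu). Qed.

Lemma delta_fix w k u : size u <= size w -> delta w k u = u.
Proof.
move=> uw; have [/prefixP[v uE]|/delta_out//] := boolP (prefix w u).
have v0 : v = [::] by apply/nilP; move: uw; rewrite uE size_cat /nilp;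
  case: (size v) => // n; rewrite addnS ltnNge leq_addr.
by rewrite uE delta_cat v0 aut_root.
Qed.

Lemma aut_delta_eq g w k : (forall u, g (w ++ u) = w ++ k u) ->
  (forall u, ~~ prefix w u -> g u = u) -> g = delta w k.
Proof.
move=> gw gn; apply: tree_aut_ext => u.
have [/prefixP[v ->]|wu] := boolP (prefix w u); first by rewrite gw delta_cat.
by rewrite gn // delta_out.
Qed.

Lemma deltaM w k h : delta w (k * h) = delta w k * delta w h.
Proof.
apply/esym/aut_delta_eq => u; rewrite autM.
  by rewrite !delta_cat.
by move=> wu; rewrite !delta_out.
Qed.

Lemma delta1 w : delta w 1 = 1.
Proof. exact/esym/aut_delta_eq. Qed.

Lemma deltaV w k : delta w k^-1 = (delta w k)^-1.
Proof. by apply: (mulIg (delta w k)); rewrite -deltaM !mulVg delta1. Qed.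

Lemma delta_inj w : injective (delta w).
Proof.
move=> k h e; apply: tree_aut_ext => u; apply: (@catI w).
by rewrite -!delta_cat e.
Qed.

Lemma section_delta w k : section (delta w k) w = k.
Proof.
apply: tree_aut_ext => u; have := sectionE (delta w k) w u.
by rewrite delta_cat delta_fix // => /catI.
Qed.

Lemma delta_delta w u k : delta (w ++ u) k = delta w (delta u k).
Proof.
apply: aut_delta_eq => v.
  have [/prefixP[z ->]|uv] := boolP (prefix u v).
    by rewrite catA !delta_cat catA.
  rewrite !delta_out //; apply: contra uv => /prefixP[z].
  by rewrite -catA => /catI ->; exact: prefix_prefix.
move=> wv; rewrite delta_out //; apply: contra wv => /prefixP[z ->].
by rewrite -catA; exact: prefix_prefix.
Qed.

(** The rigid stabilizer of [w], called [R_w] in the overview. *)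
Definition rist G w : set aut := [set g | G g /\ forall u, ~~ prefix w u -> g u = u].

(** The pointwise stabilizer of the subtree below [w], called [T_w] in the overview. *)
Definition triv G w : set aut := [set g | G g /\ forall u, g (w ++ u) = w ++ u].

Lemma rist_sub G w : rist G w `<=` G. Proof. by move=> g []. Qed.

Lemma triv_sub G w : triv G w `<=` G. Proof. by move=> g []. Qed.

Lemma triv_fix G w g : triv G w g -> g w = w.
Proof. by move=> [_ /(_ [::])]; rewrite cats0. Qed.

Lemma rist_fix G w g : rist G w g -> g w = w.
Proof.
move=> [_ gw]; have [/prefixP[u e]|nw] := boolP (prefix w (g w)).
  have /nilP u0 : nilp u by move: (size_aut g w);
    rewrite e size_cat -{2}[size w]addn0 => /addnI/eqP.
  by rewrite e u0 cats0.
by apply: (@aut_inj g); rewrite gw.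
Qed.

Lemma rist_out G w g u : rist G w g -> ~~ prefix w u -> g u = u.
Proof. by move=> [_]; apply. Qed.

Lemma subgroup_rist G w : subgroup G -> subgroup (rist G w).
Proof.
move=> sG; apply: subgroupP => [|g h [gG gw] [hG hw]|g [gG gw]].
- by split=> //; exact: subgroup1.
- by split=> [|u uw]; [exact: subgroupM|rewrite autM hw ?gw].
- by split=> [|u uw]; [exact: subgroupV|rewrite -{1}(gw u uw) aut_KV].
Qed.

Lemma subgroup_triv G w : subgroup G -> subgroup (triv G w).
Proof.
move=> sG; apply: subgroupP => [|g h [gG gw] [hG hw]|g [gG gw]].
- by split=> //; exact: subgroup1.
- by split=> [|u]; [exact: subgroupM|rewrite autM hw ?gw].
- by split=> [|u]; [exact: subgroupV|rewrite -{1}(gw u) aut_KV].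
Qed.

Lemma rist_triv_comm G w g h : rist G w g -> triv G w h -> g * h = h * g.
Proof.
move=> gr [hG ht]; apply: tree_aut_ext => u.
rewrite !autM.
have [/prefixP[v ->]|wu] := boolP (prefix w u).
  by rewrite ht sectionE (rist_fix gr) ht.
have hw : h w = w by have := ht [::]; rewrite cats0.
by rewrite !(rist_out gr) // -hw prefix_aut.
Qed.

Lemma rist_triv G w w' : size w = size w' -> w != w' -> rist G w `<=` triv G w'.
Proof.
move=> sw nw g [gG gr]; split=> // u; apply: gr.
by rewrite prefixE sw take_size_cat // eq_sym.
Qed.

Lemma rist_cat G w u : rist G (w ++ u) `<=` rist G w.
Proof.
move=> g [gG gr]; split=> // v wv; apply: gr; apply: contra wv => /prefixP[z ->].
by rewrite -catA; exact: prefix_prefix.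
Qed.

Lemma triv_cat G w u : triv G w `<=` triv G (w ++ u).
Proof. by move=> g [gG gt]; split=> // v; rewrite -catA gt. Qed.

Lemma rist_conj G w g r : subgroup G -> G g -> rist G w r -> rist G (g w) (g * r * g^-1).
Proof.
move=> sG gG [rG rw]; split; first by do 2?apply: subgroupM => //; exact: subgroupV.
move=> u gu; rewrite !autM rw ?aut_VK //.
by rewrite -(prefix_aut g) aut_VK.
Qed.

Lemma triv_conj G w g r : subgroup G -> G g -> triv G w r -> triv G (g w) (g * r * g^-1).
Proof.
move=> sG gG [rG rw]; split; first by do 2?apply: subgroupM => //; exact: subgroupV.
move=> u; rewrite !autM.
by rewrite (sectionE g^-1) aut_KV rw -{1}(aut_KV g w) -(sectionE g^-1) aut_VK.
Qed.

Lemma rist_triv_1 G w g : rist G w g -> triv G w g -> g = 1.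
Proof.
move=> [_ gr] [_ gt]; apply: tree_aut_ext => u.
by have [/prefixP[v ->]|wu] := boolP (prefix w u); [rewrite gt|rewrite gr].
Qed.

Lemma aut_neq1 g : g <> 1 -> exists u, g u <> u.
Proof.
move=> g1; apply: contrapT => nu; apply: g1; apply: tree_aut_ext => u.
by apply: contrapT => gu; apply: nu; exists u.
Qed.

(** Finitely many nontrivial automorphisms are all detected on words of some bounded length. *)
Lemma infinite_aut (S : set aut) :
  (forall n, exists g, [/\ S g, g <> 1 & forall u, size u <= n -> g u = u]) ->
  infinite_set S.
Proof.
move=> SP /finite_seqP[s sE].
have [n nP] : exists n, forall g, g \in s -> g <> 1 -> exists2 u, size u <= n & g u <> u.
  elim: s {sE} => [|g s [n nP]]; first by exists 0.
  have [->|/eqP/aut_neq1[u gu]] := eqVneq g 1.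
    by exists n => h; rewrite inE => /orP[/eqP->//|]; exact: nP.
  exists (maxn (size u) n) => h; rewrite inE => /orP[/eqP->|hs h1].
    by exists u => //; rewrite leq_maxl.
  have [v vn hv] := nP h hs h1; exists v => //; apply: leq_trans vn _.
  exact: leq_maxr.
have [g [gS g1 gn]] := SP n; move: gS; rewrite sE => /nP/(_ g1)[u un].
by apply; apply: gn.
Qed.

End TreeAutomorphisms.

(** * Consequences of regular branching *)

Section Branching.
Local Open Scope group_scope.
Local Open Scope classical_set_scope.
Variable X : finType.
Hypothesis hX : (1 < #|X|)%N.
Local Notation aut := (tree_aut X).
Variables G K : set aut.
Hypotheses (sG : subgroup G) (Gss : self_similar G) (Gsr : self_replicating G).
Hypotheses (sK : subgroup K) (KG : K `<=` G) (Kfi : finite_index G K).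
Hypothesis KX : first_level_power K `<=` K.
Implicit Types (g h k : aut) (u v w : seq X) (x y : X) (S : seq aut).

Lemma lift_section v h : G h -> exists g, [/\ G g, g v = v & section g v = h].
Proof.
elim: v h => [|x v IH] h hG.
  exists h; split=> //; [exact: aut_root|apply: tree_aut_ext => u].
  by rewrite /= /section_fun drop0.
have [g [gG gv gh]] := IH h hG; have [f [fG fx fg]] := Gsr.2 x g gG.
exists f; split=> //; rewrite -cat1s.
  by rewrite sectionE fx fg gv.
by rewrite section_cat fg gh.
Qed.

(** Lifting elements through [x] would inject a finite [G] into the stabilizer of [x], which is
    proper by transitivity. *)
Lemma self_replicating_infinite : infinite_set G.
Proof.
move=> /finite_seqP[s0 s0E]; pose s := undup s0.
have sE g : G g <-> g \in s by rewrite mem_undup s0E.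
have /card_gt1P[x [y [_ _ xy]]] := hX.
have /choice[f fP] : forall h, exists g, G h -> [/\ G g, g [:: x] = [:: x] & section g [:: x] = h].
  by move=> h; have [/(Gsr.2 x)[g gP]|] := pselect (G h); [exists g|exists h].
have fs : {subset map f s <= [seq g : aut <- s | g [:: x] == [:: x]]}.
  move=> _ /mapP[h /sE/fP[gG gx _] ->]; rewrite mem_filter gx eqxx /=.
  exact/sE.
have fu : uniq (map f s).
  rewrite map_inj_in_uniq ?undup_uniq // => g h /sE/fP[_ _ e] /sE/fP[_ _ e'] fgh.
  by rewrite -e -e' fgh.
have := uniq_leq_size fu fs; rewrite size_map size_filter leqNgt => /negP; apply.
have [g gG gx] := Gsr.1 x y; rewrite -(count_predC (fun g : aut => g [:: x] == [:: x]))
  -addn1 leq_add2l.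
rewrite -has_count; apply/hasP; exists g; first exact/sE.
by rewrite /= gx; apply: contra xy => /eqP[->].
Qed.

Lemma branch_delta w k : K k -> K (delta w k).
Proof.
elim: w => [|x w IH] kK.
  by have -> : delta [::] k = k by apply/esym/aut_delta_eq => // u; rewrite prefix0s.
rewrite -cat1s delta_delta; apply: KX => y; split; first exact: delta_fix.
have [<-|xy] := eqVneq x y; first by rewrite section_delta; exact: IH.
have -> : section (delta [:: x] (delta w k)) [:: y] = 1; last exact: subgroup1.
apply/section_fix => [|u]; first exact: delta_fix.
by rewrite delta_out //= (negbTE xy).
Qed.

Lemma branch_rist w k : K k -> rist G w (delta w k).
Proof.
move=> kK; split; first exact/KG/branch_delta.
by move=> u; exact: delta_out.
Qed.

Lemma branch_nontrivial : exists k, K k /\ k <> 1.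
Proof.
have [|k [_ kK k1]] := coset_finite_nontrivial sG self_replicating_infinite (K := K).
  exact: finite_index_coset_finite.
by exists k.
Qed.

(** If [k] moves [u], conjugation by [k] moves the support of [delta u k] from below [u] to below
    [k u]. *)
Lemma branch_noncommuting : exists a b, [/\ K a, K b & a * b <> b * a].
Proof.
have [k [kK k1]] := branch_nontrivial.
have [u ku] := aut_neq1 k1.
exists k, (delta u k); split=> //; first exact: branch_delta.
move=> /(congr1 (fun g : aut => g (u ++ u))).
rewrite !autM delta_cat delta_out; first by move=> /aut_inj/catI.
by rewrite prefixE take_aut_size take_size_cat //; exact/eqP.
Qed.

Lemma rist_infinite w : infinite_set (rist G w).
Proof.
have [k [kK k1]] := branch_nontrivial.
have /card_gt1P[x _] := hX.
apply: infinite_aut => n; exists (delta (w ++ nseq n x) k); split.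
- exact/(@rist_cat _ _ _ (nseq n x))/branch_rist.
- by rewrite -(delta1 (w ++ nseq n x)) => /delta_inj.
- move=> u un; apply: delta_fix; rewrite size_cat size_nseq.
  exact: leq_trans un (leq_addl _ _).
Qed.

(** Label [g] by the image of [w] and the [K]-coset of the section at [w]. If the labels agree,
    [g^-1 * h] fixes [w] with section in [K], and the copy of this section at [w] splits off as the
    factor in [rist G w]. *)
Lemma coset_finite_rist_triv w :
  coset_finite G [set g | exists r t, [/\ rist G w r, triv G w t & g = r * t]].
Proof.
have [I [f fP]] := finite_index_coset_finite sK Kfi.
have sw g : size (g w) == size w by rewrite size_aut.
exists ((size w).-tuple X * I)%type, (fun g => (Tuple (sw g), f (section g w))).
move=> g h gG hG [ew es].
have kK : K (section (g^-1 * h) w).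
  by rewrite sectionM -ew sectionV; apply: fP => //; exact: Gss.
have ghG : G (g^-1 * h) by apply: subgroupM => //; exact: subgroupV.
pose r := delta w (section (g^-1 * h) w).
have rr : rist G w r by exact: branch_rist.
exists r, (r^-1 * (g^-1 * h)); split=> //; last by rewrite mulVKg.
have fixw : (g^-1 * h) w = w by rewrite autM -ew aut_KV.
split; first by apply: subgroupM => //; apply: subgroupV => //; exact: rist_sub rr.
move=> u; rewrite autM sectionE fixw -deltaV delta_cat.
by rewrite aut_KV.
Qed.

Lemma triv_generates S H w : subgroup H -> H `<=` G -> rist G w `<=` H ->
  generates S H -> exists S', generates S' (triv G w `&` H).
Proof.
move=> sH HG rH; have st := subgroup_triv w sG.
apply: generates_commuting_factor (rH) _ _ _ _ => //.
- exact: subgroup_rist.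
- by apply: subgroupP => [|g h [gt gH] [ht hH]|g [gt gH]]; split;
    by [exact: subgroup1|exact: subgroupM|exact: subgroupV].
- by move=> g h gr [ht _]; exact: rist_triv_comm gr ht.
- by move=> g gr [gt _]; exact: rist_triv_1 gr gt.
- apply: (coset_finiteW HG _ sH (coset_finite_rist_triv w)).
  move=> g gH [r [t [rr tt gE]]]; exists r, t; split=> //; split=> //.
  have -> : t = r^-1 * g by rewrite gE mulKg.
  by apply: subgroupM => //; apply: subgroupV => //; exact: rH.
Qed.

Lemma rist_generates S w : generates S G -> exists S', generates S' (rist G w).
Proof.
apply: generates_commuting_factor (@triv_sub _ G w) _ _ _ _ => //.
- exact: subgroup_triv.
- exact: subgroup_rist.
- exact: rist_sub.
- by move=> g h gt hr; rewrite (rist_triv_comm hr gt).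
- by move=> g gt gr; exact: rist_triv_1 gr gt.
- apply: (coset_finiteW _ _ sG (coset_finite_rist_triv w)) => //.
  move=> g _ [r [t [rr tt gE]]]; exists t, r; split=> //.
  by rewrite gE (rist_triv_comm rr tt).
Qed.

End Branching.

Lemma seq_bound (U : eqType) (s : seq U) (P : U -> nat -> Prop) :
  (forall x m n, m <= n -> P x m -> P x n) ->
  (forall x, x \in s -> exists n, P x n) -> exists n, forall x, x \in s -> P x n.
Proof.
move=> mono; elim: s => [|x s IH] sP; first by exists 0.
have [|n nP] := IH; first by move=> y ys; apply: sP; rewrite inE ys orbT.
have [m mP] := sP x (mem_head x s).
exists (maxn m n) => y; rewrite inE => /orP[/eqP->|/nP].
  by apply: mono mP; exact: leq_maxl.
by apply: mono; exact: leq_maxr.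
Qed.

(** * Contraction and tame lifts *)

Section Contraction.
Local Open Scope group_scope.
Local Open Scope classical_set_scope.
Variable X : finType.
Local Notation aut := (tree_aut X).
Variables (G : set aut) (S : seq aut).
Hypotheses (sG : subgroup G) (Gss : self_similar G) (Gsr : self_replicating G).
Hypotheses (Gc : contracting G) (SG : generates S G).
Implicit Types (g h k s : aut) (u v w : seq X) (x y : X) (c : seq aut) (B : set aut).

Definition ball r : set aut :=
  [set g | exists c, [/\ {subset c <= S}, size c <= r & wprod c = g]].

Lemma ball_le r r' g : r <= r' -> ball r g -> ball r' g.
Proof. by move=> rr' [c [cS cr ce]]; exists c; split=> //; exact: leq_trans rr'. Qed.

Lemma ballM r r' g h : ball r g -> ball r' h -> ball (r + r') (g * h).
Proof.
move=> [c [cS cr <-]] [d [dS dr <-]]; exists (c ++ d); split.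
- by move=> z; rewrite mem_cat => /orP[/cS|/dS].
- by rewrite size_cat leq_add.
- exact: wprod_cat.
Qed.

Lemma ball_wprod c : {subset c <= S} -> ball (size c) (wprod c).
Proof. by exists c. Qed.

Lemma ball_G r g : ball r g -> G g.
Proof. by move=> [c [cS _ <-]]; apply: subgroup_wprod => // s /cS/SG.1. Qed.

Lemma G_ball g : G g -> exists r, ball r g.
Proof. by move=> /SG.2[c cS <-]; exists (size c); exact: ball_wprod. Qed.

Lemma ball_finite r : finite_set (ball r).
Proof.
elim: r => [|r IH].
  apply: (sub_finite_set (B := [set 1])) => // g [c [_ c0 <-]].
  by case: c c0.
apply: (sub_finite_set (B := [set 1] `|` \bigcup_(s in [set` S]) ((fun g => s * g) @` ball r))).
  move=> g [c [cS cr <-]]; case: c cS cr => [|s c] cS cr; first by left.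
  right; exists s; first by apply: cS; rewrite mem_head.
  exists (wprod c) => //; exists c; split=> // t tc.
  by apply: cS; rewrite inE tc orbT.
rewrite finite_setU; split=> //; apply: bigcup_finite => [|s _]; first exact: finite_seq.
exact: finite_image.
Qed.

(** [L] bounds the word length on the finite set [N], and at level [p] all sections of [ball L.+1]
    lie in [N]. Cut a word into pieces of length [L.+1]: each shrinks to length [L]. *)
Lemma contraction : exists p L, 0 < p /\ forall j g v, size v = p ->
  ball (L.+1 * j) g -> ball (L * j) (section g v).
Proof.
have [N [/finite_seqP[sN ->] NG NP]] := Gc.
have [|L LP] := @seq_bound _ sN (fun g r => ball r g) (fun g m n => @ball_le m n g).
  by move=> g gN; apply/G_ball/NG.
have /finite_seqP[sB sBE] := ball_finite L.+1.
have [||p pP] := @seq_bound _ sB (fun g m => forall v, m <= size v -> section g v \in sN).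
- by move=> g m n mn gm v nv; apply: gm; exact: leq_trans nv.
- by move=> g gB; apply/NP/(@ball_G L.+1); rewrite sBE.
exists p.+1, L; split=> // j; elim: j => [|j IH] g v vp.
  rewrite !muln0 => -[c [_ c0 <-]]; case: c c0 => //= _.
  by rewrite section1; exists [::].
move=> [c [cS cj <-]]; rewrite -(cat_take_drop L.+1 c) wprod_cat sectionM mulnS.
apply: ballM.
  apply/LP/pP; last by rewrite size_aut vp.
  suff : ball L.+1 (wprod (take L.+1 c)) by rewrite sBE.
  exists (take L.+1 c); split=> // [z /mem_take/cS//|].
  by rewrite size_take_min geq_minl.
apply: IH => //; exists (drop L.+1 c); split=> // [z /mem_drop/cS//|].
by rewrite size_drop leq_subLR -mulnS.
Qed.

(** The suffixes of [c] are the positions along the path that its letters trace from the right. *)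
Definition tame v B c := forall c1 c2, c = c1 ++ c2 -> B (section (wprod c2) v).

Definition tame_lift v B k c :=
  [/\ {subset c <= S}, wprod c v = v, section (wprod c) v = k & tame v B c].

Lemma tame_sub v B B' k c : B `<=` B' -> tame_lift v B k c -> tame_lift v B' k c.
Proof. by move=> BB' [cS cv ck cB]; split=> // c1 c2 /cB/BB'. Qed.

(** Concatenate lifts of the letters of [c0]. A suffix of the result is a suffix of one lift, with
    section in [B], times complete lifts of the remaining letters [c2], with section [wprod c2]. *)
Lemma tame_lift_word v B c0 :
  (forall s, s \in S -> exists c, tame_lift v B s c) -> B 1 -> {subset c0 <= S} ->
  exists c, tame_lift v
    [set g | exists b c1 c2, [/\ B b, c0 = c1 ++ c2 & g = b * wprod c2]] (wprod c0) c.
Proof.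
move=> SB B1; elim: c0 => [|s c0 IH] c0S.
  exists [::]; split=> //; first exact: section1.
  by move=> [|//] [|//] _; exists 1, [::], [::]; rewrite section1 mulg1.
have [|c [cS cv cE cB]] := IH; first by move=> t tc; apply: c0S; rewrite inE tc orbT.
have [|d [dS dv dE dB]] := SB s; first by apply: c0S; rewrite mem_head.
exists (d ++ c); split.
- by move=> z; rewrite mem_cat => /orP[/dS|/cS].
- by rewrite wprod_cat autM cv dv.
- by rewrite wprod_cat sectionM cv dE cE.
have suffix_c c1 c2 : c = c1 ++ c2 -> exists b c1 c2', [/\ B b, s :: c0 = c1 ++ c2' &
    section (wprod c2) v = b * wprod c2'].
  move=> /cB[b [e1 [e2 [bB -> ->]]]]; exists b, (s :: e1), e2.
  by split.
move=> c1 c2 e; have [le|lt] := leqP (size d) (size c1).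
  apply: (suffix_c (drop (size d) c1)).
  have := congr1 (drop (size d)) e; rewrite drop_size_cat // => ->.
  by rewrite drop_cat; case: ltngtP le => // ->; rewrite subnn drop0 drop_size.
set n := size d - size c1.
have dE' : d = c1 ++ take n c2.
  have := congr1 (take (size d)) e; rewrite take_size_cat // take_cat.
  by rewrite ltnNge (ltnW lt).
have c2E : c2 = take n c2 ++ c.
  by apply/eqP; move/eqP: e; rewrite {1}dE' -catA eqseq_cat // eqxx eq_sym.
rewrite c2E wprod_cat sectionM cv cE.
by exists (section (wprod (take n c2)) v), [:: s], c0; split=> //; exact: dB dE'.
Qed.

Lemma tame_bound v c : {subset c <= S} -> exists r, tame v (ball r) c.
Proof.
elim: c => [|s c IH] cS.
  exists 0 => -[|//] [|//] _; rewrite section1; by exists [::].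
have [|r rP] := IH; first by move=> t tc; apply: cS; rewrite inE tc orbT.
have [r' r'P] : exists r', ball r' (section (wprod (s :: c)) v).
  by apply/G_ball/Gss; apply: subgroup_wprod => // t /cS/SG.1.
exists (maxn r r') => -[|t c1] c2 /=; [move=> <-|case=> _ /rP].
  by apply: ball_le r'P; exact: leq_maxr.
by apply: ball_le; exact: leq_maxl.
Qed.

(* Contraction makes the sections along the lifting paths uniformly bounded over all
   vertices v. *)
Lemma tame_lifts : exists2 p, 0 < p & forall k, G k -> exists2 B, finite_set B &
  forall v, p %| size v -> exists c, tame_lift v B k c.
Proof.
have [p [L [p0 pL]]] := contraction; exists p => //.
have sw (u : p.-tuple X) : size u = p by rewrite size_tuple.
have [||R RP] := @seq_bound _ [seq (s, z) | s <- S, z <- enum {: p.-tuple X}]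
    (fun su r => exists c, tame_lift su.2 (ball r) su.1 c).
- move=> su m n mn [c cP]; exists c; apply: tame_sub cP => g; exact: ball_le.
- move=> _ /allpairsP[[s u] [/= sS _ ->]].
  have [g [gG gu gs]] := lift_section Gsr u (SG.1 _ sS).
  have [c cS ce] := SG.2 _ gG; have [r rP] := tame_bound u cS.
  by exists r, c; split=> //=; rewrite ce.
have liftR s (u : seq X) : s \in S -> size u = p -> exists c, tame_lift u (ball R.+1) s c.
  move=> sS /eqP up; have [|c cP] := RP (s, Tuple up); first exact: allpairs_f (mem_enum _ _).
  by exists c; apply: tame_sub cP => g; apply: ball_le.
(* This radius reproduces itself: [p] levels further down [ball rho] shrinks to [ball (L * R.+1)],
   and the lift from the last [p] letters adds [R.+1]. Using [R.+1] keeps [rho] positive, as the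
   root case requires. *)
pose rho := (L.+1 * R.+1)%N.
have liftS n v s : size v = (n * p)%N -> s \in S -> exists c, tame_lift v (ball rho) s c.
  elim: n v s => [|n IH] v s vn sS.
    have -> : v = [::] by apply/nilP; rewrite /nilp vn.
    have s0 g : section g [::] = g by apply: tree_aut_ext => u; rewrite /= /section_fun drop0.
    exists [:: s]; split=> /=; rewrite ?mulg1 ?s0 //.
    - by move=> t; rewrite inE => /eqP->.
    - exact: aut_root.
    move=> [|t c1] c2 /=; rewrite s0.
      by move=> <-; exists [:: s]; split=> // t; rewrite inE => /eqP->.
    by case=> _; case: c1 c2 => [|//] [|//] _; exists [::].
  pose v1 := take (n * p)%N v; pose u := drop (n * p)%N v.
  have v1n : size v1 = (n * p)%N by rewrite size_takel // vn leq_mul2r leqnSn orbT.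
  have un : size u = p by rewrite size_drop vn mulSn addnK.
  have vE : v = v1 ++ u by rewrite cat_take_drop.
  have [c0 [c0S c0u c0s c0t]] := liftR s u sS un.
  have [|||c [cS cv cE ct]] := @tame_lift_word v1 (ball rho) c0.
  - by move=> t tS; exact: IH.
  - by exists [::].
  - by [].
  rewrite vE; exists c; split=> //.
  - by rewrite sectionE cv cE c0u.
  - by rewrite section_cat cE.
  move=> c1 c2 e; have [b [e1 [e2 [bB ee sE]]]] := ct c1 c2 e.
  rewrite section_cat sE sectionM /rho mulSnr; apply: ballM; last exact: c0t ee.
  by apply: pL; rewrite ?size_aut.
move=> k kG; have [c0 c0S <-] := SG.2 _ kG.
exists (ball (rho + size c0)); first exact: ball_finite.
move=> v /dvdnP[n vn].
have [|||c cP] := @tame_lift_word v (ball rho) c0 => //.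
- by move=> s; exact: liftS vn.
- by exists [::].
exists c; apply: tame_sub cP => _ [b [c1 [c2 [bB cE ->]]]].
apply: ballM => //; apply: (@ball_le (size c2)); first by rewrite cE size_cat leq_addl.
by apply: ball_wprod => t tc; apply: c0S; rewrite cE mem_cat tc orbT.
Qed.

End Contraction.

(** * Uniform bounds on cardinalities *)

Section AtMost.
Local Open Scope classical_set_scope.
Variable Y : eqType.
Implicit Types (B C : set Y) (n : nat).

Definition at_most n B := exists2 s : seq Y, size s <= n & B `<=` [set` s].

Lemma at_mostS n B C : B `<=` C -> at_most n C -> at_most n B.
Proof. by move=> BC [s sn Cs]; exists s => //; exact: subset_trans Cs. Qed.

Lemma finite_at_most B : finite_set B -> exists n, at_most n B.
Proof. by move=> /finite_seqP[s ->]; exists (size s), s. Qed.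

Lemma at_mostU m n B C : at_most m B -> at_most n C -> at_most (m + n) (B `|` C).
Proof.
move=> [s sn Bs] [t tn Ct]; exists (s ++ t); first by rewrite size_cat leq_add.
by move=> y /= [/Bs|/Ct] /= yst; rewrite mem_cat yst ?orbT.
Qed.

Lemma at_most_image (Z : eqType) (f : Z -> Y) n (B : set Z) :
  (exists2 s : seq Z, size s <= n & B `<=` [set` s]) -> at_most n (f @` B).
Proof.
move=> [s sn Bs]; exists (map f s); first by rewrite size_map.
by move=> _ [y /Bs ys <-]; apply: map_f.
Qed.

Lemma at_most_bigcup (I : eqType) (s : seq I) (F : I -> set Y) n :
  (forall i, i \in s -> at_most n (F i)) ->
  at_most (size s * n) (\bigcup_(i in [set` s]) F i).
Proof.
elim: s => [|i s IH] sF; first by exists [::] => // y [j].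
rewrite mulSn; apply: (at_mostS _ (at_mostU (sF i (mem_head i s)) (IH _))).
  move=> y [j /=]; rewrite inE => /orP[/eqP->|js yj]; first by left.
  by right; exists j.
by move=> j js; apply: sF; rewrite inE js orbT.
Qed.

End AtMost.

(** * Essential orbits: blocks of bounded size *)

Section Blocks.
Local Open Scope group_scope.
Local Open Scope classical_set_scope.
Variable X : finType.
Local Notation aut := (tree_aut X).
Variables (G : set aut) (S : seq aut).
Hypotheses (sG : subgroup G) (SG : generates S G).
Hypothesis triv_fg : forall w : seq X, exists S', generates S' (triv G w).
Variables (Y : choiceType) (act : aut -> Y -> Y) (A : set Y).
Hypothesis actG : group_action G act.
Hypothesis err_finite : forall g, G g -> finite_set (err act A g).
Implicit Types (g h k t : aut) (u v w : seq X) (c : seq aut) (x y z : Y).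

Local Notation orb := (orb act).
Local Notation err := (err act A).

Lemma orb_conj_sub (P P' : set aut) g y : P `<=` G -> G g ->
  (forall p, P p -> P' (g * p * g^-1)) -> act g @` orb P y `<=` orb P' (act g y).
Proof.
move=> PG gG PP' _ [_ [p pP <-] <-]; exists (g * p * g^-1); first exact: PP'.
have pG := PG _ pP; have gV := subgroupV sG gG.
by rewrite (actM actG _ (subgroupM sG gG pG) gV) (actK sG actG) // (actM actG).
Qed.

Lemma orb_conj (P P' : set aut) g y : P `<=` G -> P' `<=` G -> G g ->
  (forall p, P p -> P' (g * p * g^-1)) -> (forall p, P' p -> P (g^-1 * p * g)) ->
  orb P' (act g y) = act g @` orb P y.
Proof.
move=> PG P'G gG PP' P'P; apply/seteqP; split; last exact: orb_conj_sub.
have gV := subgroupV sG gG.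
move=> x xy; exists (act g^-1 x); last exact: (actKV sG actG).
rewrite -[y](actK sG actG _ gG); apply: (orb_conj_sub P'G gV); last by exists x.
by move=> p /P'P; rewrite invgK.
Qed.

Lemma orb_triv_act g w y : G g ->
  orb (triv G (g w)) (act g y) = act g @` orb (triv G w) y.
Proof.
move=> gG; apply: orb_conj => // [||p|p]; try exact: triv_sub; first exact: triv_conj.
by move=> /(triv_conj sG (subgroupV sG gG)); rewrite aut_KV invgK.
Qed.

Lemma orb_rist_act g w y : G g ->
  orb (rist G (g w)) (act g y) = act g @` orb (rist G w) y.
Proof.
move=> gG; apply: orb_conj => // [||p|p]; try exact: rist_sub; first exact: rist_conj.
by move=> /(rist_conj sG (subgroupV sG gG)); rewrite aut_KV invgK.
Qed.

(* In the basic example Y is an orbit of ends of the tree, and the words satisfying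
   this are the prefixes of the end y. *)
Definition parabolic w y := finite_set (orb (triv G w) y) /\ infinite_set (orb (rist G w) y).

(** For distinct vertices of one level [rist G w] lies in [triv G w'], so its infinite orbit would
    sit in a finite one. *)
Lemma parabolic_uniq w w' y : size w = size w' ->
  parabolic w y -> parabolic w' y -> w = w'.
Proof.
move=> sw [_ infw] [finw' _]; apply/eqP/negPn/negP => nw; apply: infw.
by apply: sub_finite_set finw'; apply: orbS; exact: rist_triv.
Qed.

Lemma parabolic_act g w y : G g -> parabolic w y -> parabolic (g w) (act g y).
Proof.
move=> gG [fin inf]; split; first by rewrite orb_triv_act //; exact: finite_image.
rewrite orb_rist_act // => fin'; apply: inf.
apply: (finite_set_inj (f := act g) _ _ fin') => [x x' _ _|x xy]; last by exists x.
exact: (act_inj sG actG).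
Qed.

Lemma parabolic_cat w u y : parabolic (w ++ u) y -> parabolic w y.
Proof.
move=> [fin inf]; split; first by apply: sub_finite_set fin; apply: orbS; exact: triv_cat.
by apply: sub_infinite_set inf; apply: orbS; exact: rist_cat.
Qed.

Lemma parabolic_block w x y : parabolic w y -> orb (triv G w) y x -> parabolic w x.
Proof.
by move=> py [t tw <-]; rewrite -(triv_fix tw); apply: parabolic_act py; exact: triv_sub tw.
Qed.

Lemma mixed_orb (P : set aut) y : mixed act A P y <-> exists2 x, orb P y x & A x <> A y.
Proof.
by split=> [[p pP py]|[_ [p pP <-] py]]; [exists (act p y) => //; exists p|exists p].
Qed.

Section BlockBound.
Variable F : seq Y.
Hypothesis FE : errs act A S = [set` F].

(* Along a shortest path of blocks from a full one to an empty one, every point of the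
   first block meets an error on its way, and different points meet different ones. *)
Lemma block_bound w y g : G g -> parabolic w y -> orb (triv G w) y `<=` A ->
  (forall x, orb (triv G (g w)) (act g y) x -> ~ A x) ->
  at_most (size F) (orb (triv G w) y).
Proof.
move=> gG py full empty.
(* The lengths of words that carry the block of [y] off [A]; the least one is used. *)
pose P n := `[< exists c, [/\ {subset c <= S}, size c = n &
  forall x, orb (triv G (wprod c w)) (act (wprod c) y) x -> ~ A x] >].
have [|_ /asboolP[c [cS <- cempty]] cmin] := @ex_minnP P.
  have [c cS ce] := SG.2 _ gG; exists (size c); apply/asboolP; exists c.
  by rewrite ce.
have cG c1 c2 : c = c1 ++ c2 -> G (wprod c2).
  move=> ce; apply: subgroup_wprod => // s sc; apply/SG.1/cS.
  by rewrite ce mem_cat sc orbT.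
have /choice[f fP] : forall x, exists c2, orb (triv G w) y x ->
    exists c1 s, c = c1 ++ s :: c2 /\ err s (act (wprod c2) x).
  move=> x; have [yx|] := pselect (orb (triv G w) y x); last by exists [::].
  have : err (wprod c) x.
    move=> e; apply: (cempty (act (wprod c) x)); last by rewrite e; exact: full.
    rewrite orb_triv_act; last exact: (cG [::]).
    by exists x.
  move=> /(err_wprod sG actG)[s /cS/SG.1//|c1 [s [c2 [ce se]]]].
  by exists c2 => _; exists c1, s.
pose phi x := act (wprod (f x)) x.
have inj x x' : orb (triv G w) y x -> orb (triv G w) y x' -> size (f x) <= size (f x') ->
    phi x = phi x' -> x = x'.
  move=> yx yx' le e; have [c1 [s [ce _]]] := fP x yx; have [c1' [s' [ce' _]]] := fP x' yx'.
  move: le; rewrite leq_eqVlt => /orP[/eqP se|lt].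
    have fE : f x = f x'.
      have := congr1 (drop (size c1).+1) ce; rewrite {1}ce'.
      have sc : size c1' = size c1.
        by have := congr1 size ce; rewrite {1}ce' !size_cat /= se => /addIn.
      by rewrite -!cat_rcons !drop_size_cat ?size_rcons ?sc.
    by move: e; rewrite /phi fE; apply: (act_inj sG actG); apply: (cG (rcons c1 s));
      rewrite cat_rcons -fE.
  (* The path from [x] reaches the common error sooner and then follows the rest of the path from
     [x']. The word [d] is shorter than [c] but leads to the same block, since [parabolic_uniq]
     identifies the vertices. *)
  exfalso; pose d := c1' ++ s' :: f x.
  have hfG : G (wprod (rcons c1' s')).
    apply: subgroup_wprod => // t tc; apply/SG.1/cS; rewrite ce' -cat_rcons mem_cat.
    by rewrite tc.
  have fxG : G (wprod (f x)) by apply: (cG (rcons c1 s)); rewrite cat_rcons.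
  have fx'G : G (wprod (f x')) by apply: (cG (rcons c1' s')); rewrite cat_rcons.
  have dE : wprod d = wprod (rcons c1' s') * wprod (f x) by rewrite -wprod_cat cat_rcons.
  have cE : wprod c = wprod (rcons c1' s') * wprod (f x').
    by rewrite {1}ce' -wprod_cat cat_rcons.
  have dG : G (wprod d) by rewrite dE; exact: subgroupM.
  have wcG : G (wprod c) by rewrite cE; exact: subgroupM.
  have dx : act (wprod d) x = act (wprod c) x'.
    by rewrite dE cE !(actM actG) //; congr (act _ _).
  have px := parabolic_block py yx; have px' := parabolic_block py yx'.
  have dw : wprod d w = wprod c w.
    apply: (@parabolic_uniq _ _ (act (wprod d) x)); first by rewrite !size_aut.
      exact: parabolic_act.
    by rewrite dx; exact: parabolic_act.
  have sT := subgroup_triv w sG; have TG := @triv_sub _ G w.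
  have : P (size d).
    apply/asboolP; exists d; split=> //.
      move=> t; rewrite mem_cat inE => /or3P[tc|/eqP->|tx]; apply: cS.
      - by rewrite ce' mem_cat tc.
      - by rewrite ce' mem_cat mem_head orbT.
      - by rewrite ce mem_cat inE tx !orbT.
    move=> x2; rewrite orb_triv_act // -(orb_eq sG actG sT TG yx) -orb_triv_act //.
    rewrite dw dx orb_triv_act // (orb_eq sG actG sT TG yx') -orb_triv_act //.
    exact: cempty.
  move=> /cmin; rewrite ce' !size_cat /= leq_add2l ltnS.
  by rewrite leqNgt lt.
have [/finite_seqP[s0 s0E] _] := py; exists (undup s0); last first.
  by rewrite s0E => x; rewrite /= mem_undup.
have s0P x : x \in undup s0 -> orb (triv G w) y x by rewrite mem_undup s0E.
rewrite -(size_map phi (undup s0)); apply: uniq_leq_size.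
  rewrite map_inj_in_uniq ?undup_uniq // => x x' /s0P yx /s0P yx' e.
  by case/orP: (leq_total (size (f x)) (size (f x'))) => le; [|apply/esym]; apply: inj.
move=> _ /mapP[x /s0P yx ->]; have [c1 [s [ce se]]] := fP x yx.
have : errs act A S (phi x) by exists s => //; apply: cS; rewrite ce mem_cat mem_head orbT.
by rewrite FE.
Qed.

End BlockBound.

(** The second case of the overview, witnessed at level [n] somewhere in the [G]-orbit of [z]. *)
Definition essential n z := exists y w, [/\ orb G z y, size w = n,
  finite_set (orb (triv G w) y) & split_by A (orb (rist G w) y)].

Lemma essential_antimono m n z : m <= n -> essential n z -> essential m z.
Proof.
move=> mn [y [w [zy wn fin [i1 i2]]]]; exists y, (take m w).
have wE := cat_take_drop m w.
split=> //; first by rewrite size_takel ?wn.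
  by apply: sub_finite_set fin; apply: orbS; rewrite -{2}wE; exact: triv_cat.
have sub : orb (rist G w) y `<=` orb (rist G (take m w)) y.
  by apply: orbS; rewrite -{1}wE; exact: rist_cat.
by split; [apply: sub_infinite_set i1|apply: sub_infinite_set i2]; move=> x [/sub].
Qed.

Section EssentialOrbit.
Variable z : Y.
Hypothesis zess : forall n, essential n z.
Variable F : seq Y.
Hypothesis FE : errs act A S = [set` F].

Lemma essential_parabolic n y : orb G z y -> exists2 w, size w = n & parabolic w y.
Proof.
move=> [g gG <-]; have [_ [w [[h hG <-] wn fin [inf _]]]] := zess n.
have gh : G (g * h^-1) by apply: subgroupM => //; exact: subgroupV.
exists ((g * h^-1) w); first by rewrite size_aut.
rewrite -[act g z](_ : act (g * h^-1) (act h z) = _).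
  apply: parabolic_act => //; split=> //.
  by apply: sub_infinite_set inf => x [].
by rewrite -(actM actG) // mulgVK.
Qed.

(** The orbit of [y0] under [rist G w0] has infinitely many points on each side of [A] and finitely
    many in mixed blocks. So it meets a block inside [A] and one outside, and [block_bound] applies.
    The given block is a translate of the former. *)
Lemma essential_block_bound w y : orb G z y -> parabolic w y ->
  at_most (size F) (orb (triv G w) y).
Proof.
move=> [g gG <-] py; have [y0 [w0 [zy0 ws fin [inf1 inf2]]]] := zess (size w).
have [S' TS'] := triv_fg w0.
have sT := subgroup_triv w0 sG; have TG := @triv_sub _ G w0.
have sR := subgroup_rist w0 sG; have RG := @rist_sub _ G w0.
have finM := mixed_finite sG actG err_finite sT TG TS'.
have py0 : parabolic w0 y0 by split=> //; apply: sub_infinite_set inf1 => x [].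
have pr r : rist G w0 r -> parabolic w0 (act r y0).
  by move=> rr; rewrite -(rist_fix rr); apply: parabolic_act py0; exact: RG.
have pick (B : set Y) : infinite_set (orb (rist G w0) y0 `&` B) ->
    exists r, [/\ rist G w0 r, B (act r y0) & ~ mixed act A (triv G w0) (act r y0)].
  move=> /infinite_setD/(_ finM)/infinite_setN0[_ [[[r rr <-] rB] nM]].
  by exists r; split=> // m; apply: nM; split=> //; case: (pr r rr).
have [r1 [r1r r1A r1m]] := pick _ inf1; have [r2 [r2r r2A r2m]] := pick (~` A) inf2.
have r1G := RG _ r1r; have r2G := RG _ r2r.
have r12 : G (r2 * r1^-1) by apply: subgroupM => //; exact: subgroupV.
have bnd : at_most (size F) (orb (triv G w0) (act r1 y0)).
  apply: (@block_bound F FE w0 _ (r2 * r1^-1)) => //; first exact: pr.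
    move=> _ [t tw <-].
    suff -> : A (act t (act r1 y0)) = A (act r1 y0) by [].
    by apply: contrapT => ne; apply: r1m; exists t.
  have -> : (r2 * r1^-1) w0 = w0.
    by rewrite autM -{1}(rist_fix r1r) aut_KV (rist_fix r2r).
  rewrite -(actM actG) // mulgVK => _ [t tw <-] At; apply: r2A.
  suff <- : A (act t (act r2 y0)) = A (act r2 y0) by [].
  by apply: contrapT => ne; apply: r2m; exists t.
have [h hG hz] := zy0.
have ghG : G (g * h^-1) by apply: subgroupM => //; exact: subgroupV.
have q : G (g * h^-1 * r1^-1) by apply: subgroupM => //; exact: subgroupV.
have yE : act g z = act (g * h^-1 * r1^-1) (act r1 y0).
  by rewrite -(actM actG _ q r1G) mulgVK -hz -(actM actG _ ghG hG) mulgVK.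
have wE : w = (g * h^-1 * r1^-1) w0.
  apply: (@parabolic_uniq _ _ (act g z)) => //; first by rewrite size_aut.
  by rewrite yE; apply: parabolic_act => //; exact: pr.
by rewrite yE {1}wE orb_triv_act //; exact: at_most_image.
Qed.

(** The blocks of [z] grow with the level but have at most [size F] points, so they are constant
    from the level of a largest one on; translation extends this to the whole orbit. *)
Lemma essential_block_stable : exists n, forall w y, orb G z y -> parabolic w y ->
  n <= size w -> orb (triv G w) y = orb (triv G (take n w)) y.
Proof.
pose P j := `[< exists w s, [/\ parabolic w z, uniq s, size s = j &
  [set` s] `<=` orb (triv G w) z] >].
have zz : orb G z z by exact: (orb_refl actG).
have [||_ /asboolP[w1 [s [pw1 us <- sT]]] smax] := @ex_maxnP P (size F).
- have [w _ pw] := essential_parabolic 0 zz.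
  by exists 0; apply/asboolP; exists w, [::].
- move=> _ /asboolP[w [s [pw us <- sT]]].
  have [s' s'F Ts'] := essential_block_bound zz pw.
  by apply: leq_trans s'F; apply: uniq_leq_size => // x /sT/Ts'.
exists (size w1) => w y [g gG <-] pw w1w.
have gV := subgroupV sG gG.
pose w' := (g^-1)%g w.
have gw' : g w' = w by rewrite aut_VK.
have pw' : parabolic w' z.
  by rewrite -[z](actK sG actG _ gG); exact: parabolic_act.
have tw' : take (size w1) w' = w1.
  apply: (@parabolic_uniq _ _ z) => //; first by rewrite size_takel ?size_aut.
  by apply: (@parabolic_cat _ (drop (size w1) w')); rewrite cat_take_drop.
have TT : orb (triv G w1) z `<=` orb (triv G w') z.
  by apply: orbS; rewrite -{1}tw' -[X in _ `<=` triv G X](cat_take_drop (size w1)); exact: triv_cat.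
rewrite -gw' take_aut_size tw' !orb_triv_act //; congr (_ @` _).
apply/seteqP; split=> // x xT; apply: (sT) => /=; apply: contrapT => /negP nx.
suff : P (size s).+1 by move/smax; rewrite ltnn.
apply/asboolP; exists w', (x :: s); split; rewrite //= ?nx //.
by move=> x'; rewrite /= inE => /orP[/eqP->//|/sT/TT].
Qed.

(** If the ray of an error [y] avoids [v], then [g] acts on [y] within its block, which is mixed.
    Otherwise a tame lift [c] of [k] replaces [g]: unless [y] or [act g y] lies in a mixed block,
    the path of [c] from [y] meets an error. All counts are independent of [v]. *)
Lemma essential_err_bound p :
  (forall k, G k -> exists2 B, finite_set B &
     forall v, p %| size v -> exists c, tame_lift S v B k c) ->
  exists n, forall k, G k -> exists C, forall v g, n <= size v -> p %| size v ->
    rist G v g -> section g v = k -> at_most C (err g `&` orb G z).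
Proof.
move=> lifts; have [n stable] := essential_block_stable; exists n => k kG.
have [_ /finite_seqP[sB ->] tl] := lifts k kG.
(* By stability [M] contains every mixed block of the orbit at level [n] or deeper. *)
pose M := \bigcup_(w in [set: n.-tuple X])
  [set y | finite_set (orb (triv G w) y) /\ mixed act A (triv G w) y].
have finM : finite_set M.
  apply: bigcup_finite => [|w _]; first exact: finite_finset.
  have [S' TS'] := triv_fg w.
  exact: (mixed_finite sG actG err_finite (subgroup_triv w sG) (@triv_sub _ _ _) TS').
have mixedM w y : orb G z y -> parabolic w y -> n <= size w ->
    mixed act A (triv G w) y -> M y.
  move=> zy pw nw; have st : size (take n w) == n by rewrite size_takel.
  rewrite mixed_orb (stable w y zy pw nw) => m; exists (Tuple st) => //.
  split; last exact/mixed_orb.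
  by rewrite -(stable w y zy pw nw); case: pw.
have [m [sM sMm MsM]] := finite_at_most finM.
(* The points carried to the error [eb.1] by an element with section [eb.2] at [v]. Two such
   elements differ by a factor in [triv G v], so these points lie in one block. *)
pose W v (eb : Y * aut) := [set y | orb G z y /\ exists h, [/\ G h, parabolic v y,
  act h y = eb.1 & section h v = eb.2]].
have Wbound v eb : at_most (size F) (W v eb).
  have [[y [zy [h [hG py hy hv]]]]|nW] := pselect (exists y, W v eb y); last first.
    by exists [::] => // y Wy; case: nW; exists y.
  apply: at_mostS (essential_block_bound zy py) => y' [zy' [h' [h'G py' h'y' h'v]]].
  have hvE : h v = h' v.
    apply: (@parabolic_uniq _ _ eb.1); first by rewrite !size_aut.
      by rewrite -hy; exact: parabolic_act.
    by rewrite -h'y'; exact: parabolic_act.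
  have hV := subgroupV sG hG.
  apply: (orb_sym sG actG (subgroup_triv v sG) (@triv_sub _ _ _)).
  exists (h^-1 * h'); last by rewrite (actM actG) // h'y' -hy (actK sG actG).
  split; first exact: subgroupM.
  have fixv : (h^-1 * h') v = v by rewrite autM -hvE aut_KV.
  by apply/(section_fix fixv); rewrite sectionM -hvE sectionV h'v -hv mulVg.
pose FB := [seq (e, b) | e <- F, b <- sB].
exists (m + m + size FB * size F)%N => v g nv pv gr gk.
have gG := rist_sub gr; have gV := subgroupV sG gG.
apply: (@at_mostS _ _ _ (M `|` act g^-1 @` M `|` \bigcup_(eb in [set` FB]) W v eb)); last first.
  apply: at_mostU; last by apply: at_most_bigcup.
  by apply: at_mostU; [exists sM|apply: at_most_image; exists sM].
move=> y [gy zy]; have [w wv pw] := essential_parabolic (size v) zy.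
have nw : n <= size w by rewrite wv.
have [wE|vw] := eqVneq v w; last first.
  by left; left; apply: (mixedM w) => //; exists g => //; apply: rist_triv gr.
rewrite -wE in pw => {w wv nw wE}.
have [c [cS cv ck cB]] := tl v pv.
have cG : G (wprod c) by apply: subgroup_wprod => // s /cS/SG.1.
have tw : triv G v (g^-1 * wprod c).
  split; first exact: subgroupM.
  have fixv : (g^-1 * wprod c) v = v by rewrite autM cv -{1}(rist_fix gr) aut_KV.
  apply/(section_fix fixv); rewrite sectionM cv ck.
  by rewrite -{1}(rist_fix gr) sectionV gk mulVg.
have [my|nmy] := pselect (mixed act A (triv G v) y); first by left; left; exact: (mixedM v).
have zgy : orb G z (act g y).
  by apply: (orb_trans actG sG (fun _ => id) zy); exists g.
have [mgy|nmgy] := pselect (mixed act A (triv G v) (act g y)).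
  left; right; exists (act g y); last exact: (actK sG actG).
  by apply: (mixedM v) => //; rewrite -(rist_fix gr); exact: parabolic_act.
right; have : err (wprod c) y.
  (* Thus [wprod c] acts as [g] followed by an element of [triv G v], which does not change
     membership in [A] on the unmixed block of [act g y]. *)
  have cE : wprod c = g^-1 * wprod c * g.
    by rewrite -(rist_triv_comm gr tw) mulVKg.
  move=> e; apply: gy; rewrite -e {1}cE (actM actG _ (triv_sub tw) gG).
  apply: contrapT => ne; apply: nmgy.
  by exists (g^-1 * wprod c) => // e'; apply: ne; rewrite e'.
move=> /(err_wprod sG actG)[s /cS/SG.1//|c1 [s [c2 [ce se]]]].
exists (act (wprod c2) y, section (wprod c2) v); last first.
  split=> //; exists (wprod c2); split=> //.
  apply: subgroup_wprod => // t tc; apply/SG.1/cS; rewrite ce mem_cat inE tc !orbT //.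
apply: allpairs_f; last by apply: (cB (rcons c1 s)); rewrite cat_rcons.
have : errs act A S (act (wprod c2) y).
  by exists s => //; apply: cS; rewrite ce mem_cat mem_head orbT.
by rewrite FE.
Qed.

End EssentialOrbit.
End Blocks.

(** * Inessential orbits: commutators with few errors *)

Section InessentialOrbits.
Local Open Scope group_scope.
Local Open Scope classical_set_scope.
Variable X : finType.
Hypothesis hX : 1 < #|X|.
Local Notation aut := (tree_aut X).
Variable G : set aut.
Hypothesis sG : subgroup G.
Hypothesis triv_fg : forall w : seq X, exists S', generates S' (triv G w).
Hypothesis rist_fg : forall w : seq X, exists S', generates S' (rist G w).
Hypothesis triv_rist_fg : forall w u : seq X,
  exists S', generates S' (triv G (w ++ u) `&` rist G w).
Hypothesis rist_inf : forall w : seq X, infinite_set (rist G w).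
Hypothesis rist_triv_cf : forall w : seq X,
  coset_finite G [set g | exists r t, [/\ rist G w r, triv G w t & g = r * t]].
Variables (Y : choiceType) (act : aut -> Y -> Y) (A : set Y).
Hypothesis actG : group_action G act.
Hypothesis err_finite : forall g, G g -> finite_set (err act A g).
Implicit Types (g h k a b : aut) (u v : seq X) (x y z e : Y) (M : set aut).

Local Notation orb := (orb act).
Local Notation err := (err act A).

Definition commutator a b : aut := a * b * a^-1 * b^-1.

Lemma split_byS (B C : set Y) : B `<=` C -> split_by A B -> split_by A C.
Proof.
by move=> BC [i1 i2]; split; [apply: sub_infinite_set i1|apply: sub_infinite_set i2];
  move=> x [/BC].
Qed.

Variable w : seq X.

Local Notation R := (rist G w).
Local Notation T := (triv G w).

Let sR : subgroup R := subgroup_rist w sG.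
Let sT : subgroup T := subgroup_triv w sG.

(** These [p] act on [y] as elements of [T] do; since [T] commutes with [R], they normalize the
    stabilizer of [y] in [R]. *)
Lemma almost_fixer_coset_finite y : infinite_set (orb T y) -> split_by A (orb R y) ->
  coset_finite R [set p | orb T y (act p y)].
Proof.
move=> infT spl; have [S' TS'] := triv_fg w.
apply: (split_product_orbit sG actG err_finite sR sT _ _ _ TS' infT) => //.
- exact: rist_sub.
- exact: triv_sub.
- by move=> p q; exact: rist_triv_comm.
apply: split_byS spl => x [p pR <-]; exists p => //.
exact: (orb_refl actG).
Qed.

Lemma act_eqV g x y : G g -> act g x = y -> act g^-1 y = x.
Proof. by move=> gG <-; rewrite (actK sG actG). Qed.

(** Otherwise the stabilizer of [y] in [R] is trivial below [w ++ v], so the rigid stabilizer of the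
    child [w ++ v2] acts freely at [y] and [Q] has an infinite orbit. By [split_product_orbit] some
    nontrivial [p] supported below [w ++ v1] acts on [y] like some [q] in [Q]. Then [q^-1 * p] fixes
    [y] but acts as [p] below [w ++ v1]. *)
Lemma stabilizer_moves v y : split_by A (orb R y) ->
  exists h u, [/\ R h, act h y = y & h (w ++ v ++ u) <> w ++ v ++ u].
Proof.
move=> spl; apply: contrapT => nex.
have fixv h u : R h -> act h y = y -> h (w ++ v ++ u) = w ++ v ++ u.
  by move=> hR hy; apply: contrapT => ne; apply: nex; exists h, u.
have /card_gt1P[x1 [x2 [_ _ x12]]] := hX.
pose v1 := v ++ [:: x1]; pose v2 := v ++ [:: x2].
have RG := @rist_sub _ G w.
have R1R : rist G (w ++ v1) `<=` R by exact: rist_cat.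
pose Q := triv G (w ++ v1) `&` R.
have sR1 := subgroup_rist (w ++ v1) sG; have sT1 := subgroup_triv (w ++ v1) sG.
have sQ : subgroup Q.
  apply: subgroupP => [|g h [gt gH] [ht hH]|g [gt gH]]; split;
    by [exact: subgroup1|exact: subgroupM|exact: subgroupV].
have R2Q : rist G (w ++ v2) `<=` Q.
  move=> g gr; split; last exact: rist_cat gr.
  apply: rist_triv gr; first by rewrite !size_cat.
  by apply: contra x12 => /eqP/catI/catI[->].
have [S' QS'] := triv_rist_fg w v1.
have cf : coset_finite (rist G (w ++ v1)) [set p | orb Q y (act p y)].
  apply: (split_product_orbit sG actG err_finite sR1 sQ _ _ _ QS').
  - exact: rist_sub.
  - by move=> g [_ /RG].
  - by move=> p q pR [qT _]; exact: rist_triv_comm qT.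
  - have sR2 := subgroup_rist (w ++ v2) sG.
    move=> fin; apply: (@rist_inf (w ++ v2)).
    apply: (finite_set_inj (f := act^~ y) _ _ fin) => [g h gr hr e|g gr]; last first.
      by exists g => //; exact: R2Q.
    have gG := rist_sub gr; have hG := rist_sub hr.
    have : h^-1 * g = 1; last by move=> /(congr1 (fun k => h * k)); rewrite mulVKg mulg1.
    have hgr : rist G (w ++ v2) (h^-1 * g) by apply: subgroupM => //; exact: subgroupV.
    apply: (rist_triv_1 hgr); split; first exact: rist_sub hgr.
    move=> u; rewrite -!catA; apply: fixv; first exact: rist_cat hgr.
    by rewrite (actM actG) // ?e ?(actK sG actG) //; exact: subgroupV.
  apply: split_byS (split_by_coset_finite sG actG err_finite RG sR (K := [set g | R g /\
      exists r t, [/\ rist G (w ++ v1) r, triv G (w ++ v1) t & g = r * t]]) _ spl).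
    move=> _ [g [gR [r [t [rr tt gE]]]] <-]; exists r => //; exists t.
      split=> //; have -> : t = r^-1 * g by rewrite gE mulKg.
      by apply: subgroupM => //; apply: subgroupV => //; exact: R1R.
    by rewrite gE (rist_triv_comm rr tt) (actM actG) //; [exact: triv_sub tt|exact: rist_sub rr].
  by apply: (coset_finiteW RG _ sR (rist_triv_cf (w ++ v1))).
have [p [pR [q [qT qR] qp] p1]] := coset_finite_nontrivial sR1 (@rist_inf _) cf.
apply: p1; apply: (rist_triv_1 pR); split; first exact: rist_sub pR.
move=> u.
have qV : triv G (w ++ v1) q^-1 by exact: subgroupV.
have hR : R (q^-1 * p).
  by apply: subgroupM => //; [exact: subgroupV|exact: R1R].
have hy : act (q^-1 * p) y = y.
  rewrite (actM actG) -?qp ?(actK sG actG) //; last exact: rist_sub pR.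
    exact: RG.
  exact: triv_sub qV.
have := fixv _ ([:: x1] ++ u) hR hy.
rewrite autM !catA -(catA w v) sectionE (rist_fix pR).
by case: qV => _ ->.
Qed.

(* A normal subgroup containing an element h that moves a vertex u contains the
   commutators of elements a, b supported below u, since [h, a^-1] differs from a by an
   element supported below h u. *)
Lemma commutators_fix y v : infinite_set (orb T y) -> split_by A (orb R y) ->
  exists u, forall a b, orb T y (act a y) -> orb T y (act b y) ->
    rist G (w ++ v ++ u) a -> rist G (w ++ v ++ u) b -> act (commutator a b) y = y.
Proof.
move=> infT spl; have [h [u [hR hy hu]]] := stabilizer_moves v spl.
exists u => a b [q qT qa] [q' q'T q'b] aR bR.
have RG := @rist_sub _ G w; have TG := @triv_sub _ G w.
have aRw : R a by exact: rist_cat aR.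
have bRw : R b by exact: rist_cat bR.
have [aG bG hG qG q'G] : [/\ G a, G b, G h, G q & G q'].
  by split; [exact: RG|exact: RG|exact: RG|exact: TG|exact: TG].
have [aV bV hV q'V] : [/\ G a^-1, G b^-1, G h^-1 & G q'^-1].
  by split; exact: subgroupV.
pose c := h * a^-1 * h^-1 * a.
(* As [a] acts on [y] like [q], which commutes with [h], conjugation by [a] keeps [h^-1] in the
   stabilizer of [y]. *)
have hay : act (a^-1 * h^-1 * a) y = y.
  have hVR := subgroupV sR hR.
  rewrite (actM actG) ?(actM actG) // -?qa; last exact: subgroupM.
  rewrite -(actM actG _ hV qG) (rist_triv_comm hVR qT) (actM actG) //.
  by rewrite (act_eqV hG hy) qa (actK sG actG).
have cR : R c by do ?[apply: subgroupM => //]; exact: subgroupV.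
have cG := RG _ cR; have cV := subgroupV sG cG.
have cy : act c y = y.
  rewrite /c -!mulgA (actM actG) // ?(mulgA a^-1) ?hay //.
  by do ?[apply: subgroupM => //].
have bcy : act (b * c^-1 * b^-1) y = y.
  have bVy : act b^-1 y = act q'^-1 y.
    apply: (act_eqV bG); rewrite -(actM actG) //.
    rewrite (rist_triv_comm bRw (subgroupV sT q'T)) (actM actG) // -q'b.
    exact: (actK sG actG).
  have cVR := subgroupV sR cR.
  rewrite (actM actG) ?(actM actG) ?bVy //; last exact: subgroupM.
  rewrite -(actM actG _ cV q'V) (rist_triv_comm cVR (subgroupV sT q'T)) (actM actG) //.
  by rewrite (act_eqV cG cy) -bVy (actKV sG actG).
(* The factor [x] of [c] is supported below a different vertex of the same level, so it commutes
   with [a * b * a^-1] and cancels. *)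
have -> : commutator a b = c * (b * c^-1 * b^-1).
  pose x := h * a^-1 * h^-1.
  have xR : rist G (h (w ++ v ++ u)) x by apply: rist_conj => //;
    exact: subgroupV (subgroup_rist _ sG) aR.
  have xT : triv G (w ++ v ++ u) x.
    by apply: rist_triv xR; [rewrite size_aut|exact/eqP].
  have abaR : rist G (w ++ v ++ u) (a * b * a^-1).
    have sR' := subgroup_rist (w ++ v ++ u) sG.
    by apply: subgroupM => //; [exact: subgroupM|exact: subgroupV].
  have -> : c = x * a by [].
  rewrite invgM /commutator.
  have -> : x * a * (b * (a^-1 * x^-1) * b^-1) = x * (a * b * a^-1) * x^-1 * b^-1.
    by rewrite !mulgA.
  by rewrite -(rist_triv_comm abaR xT) mulgK.
rewrite (actM actG) ?bcy //.
by do ?[apply: subgroupM => //].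
Qed.

(** The freedom in [v] lets finitely many such properties be imposed, each below the previous
    one. *)
Definition deep_commutators (Phi : aut -> Prop) := exists2 M, coset_finite R M &
  forall v, exists u, forall a b, M a -> M b ->
    rist G (w ++ v ++ u) a -> rist G (w ++ v ++ u) b -> Phi (commutator a b).

Lemma deep_commutators_seq (I : eqType) (L : seq I) (Phi : I -> aut -> Prop) :
  (forall i, i \in L -> deep_commutators (Phi i)) ->
  deep_commutators (fun g => forall i, i \in L -> Phi i g).
Proof.
elim: L => [|i L IH] LP.
  exists setT; last by exists [::].
  by exists bool, (fun=> true).
have [M cM MP] := LP i (mem_head i L).
have [|M' cM' M'P] := IH; first by move=> j jL; apply: LP; rewrite inE jL orbT.
exists (M `&` M'); first exact: coset_finiteI.
move=> v; have [u uP] := MP v; have [u' u'P] := M'P (v ++ u).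
exists (u ++ u') => a b [aM aM'] [bM bM'] aR bR j; rewrite inE => /orP[/eqP->|jL].
  by apply: uP => //; apply: (@rist_cat _ _ _ u'); rewrite -!catA.
by apply: u'P => //; rewrite -!catA.
Qed.

(** The union of the finite ones among the two parts into which [A] cuts the [R]-orbit of [e]. *)
Definition small_side e := [set y | orb R e y /\
  (A y /\ finite_set (orb R e `&` A) \/ ~ A y /\ finite_set (orb R e `\` A))].

Lemma small_side_finite e : finite_set (small_side e).
Proof.
have [f1|i1] := pselect (finite_set (orb R e `&` A)); last first.
  have [f2|i2] := pselect (finite_set (orb R e `\` A)).
    by apply: sub_finite_set f2 => y [ye [[_ /i1]|[]]].
  by apply: (sub_finite_set (B := set0)) => // y [_ [[_ /i1]|[_ /i2]]].
have [f2|i2] := pselect (finite_set (orb R e `\` A)); last first.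
  by apply: sub_finite_set f1 => y [ye [[]|[_ /i2]]].
apply: (sub_finite_set (B := (orb R e `&` A) `|` (orb R e `\` A))).
  by move=> y [ye [[]|[]]]; [left|right].
by rewrite finite_setU.
Qed.

Definition inessential y := forall x, orb R y x ->
  ~ (finite_set (orb T x) /\ split_by A (orb R x)).

(** If [A] does not split the orbit, an error starts or ends on a finite side. If it does,
    [commutators_fix] is used at finitely many points [act r e]. Every point of the orbit is a
    [T]-translate of one of them, and [T] commutes with the commutators, so these fix the orbit
    pointwise. *)
Lemma inessential_orbit e : inessential e -> deep_commutators (fun g =>
  forall y, orb R e y -> err g y -> small_side e y \/ small_side e (act g y)).
Proof.
move=> ine; have RG := @rist_sub _ G w; have ee : orb R e e by exact: (orb_refl actG).
have [spl|nspl] := pselect (split_by A (orb R e)); last first.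
  exists setT; first by exists bool, (fun=> true).
  move=> v; exists [::] => a b _ _ aR bR y ey gy.
  have aRw : R a by exact: rist_cat aR.
  have bRw : R b by exact: rist_cat bR.
  have gR : R (commutator a b).
    by do ?[apply: subgroupM => //]; exact: subgroupV.
  have gyR : orb R e (act (commutator a b) y).
    by apply: (orb_trans actG sR RG ey); exists (commutator a b).
  have [f1|i1] := pselect (finite_set (orb R e `&` A)).
    have [Ay|nAy] := pselect (A y); first by left; split=> //; left.
    right; split=> //; left; split=> //; apply: contrapT => nA; apply: gy.
    by apply/propext; split.
  have f2 : finite_set (orb R e `\` A) by apply: contrapT => i2; apply: nspl.
  have [Ay|nAy] := pselect (A y); last by left; split=> //; right.
  right; split=> //; right; split=> // A'; apply: gy.
  by apply/propext; split.
have splx x : orb R e x -> split_by A (orb R x) by move=> ex; rewrite (orb_eq sG actG sR RG ex).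
have infT x : orb R e x -> infinite_set (orb T x).
  by move=> ex fin; apply: (ine x ex); split=> //; exact: splx.
have [L [LR LP]] := coset_finite_reps (almost_fixer_coset_finite (infT e ee) spl).
have := @deep_commutators_seq _ L (fun r g => act g (act r e) = act r e).
case=> [r rL|M cM MP].
  have er : orb R e (act r e) by exists r => //; exact: LR.
  exists [set p | orb T (act r e) (act p (act r e))].
    by apply: almost_fixer_coset_finite; [exact: infT|exact: splx].
  move=> v; have [u uP] := commutators_fix v (infT _ er) (splx _ er).
  by exists u => a b; exact: uP.
exists M => // v; have [u uP] := MP v; exists u => a b aM bM aR bR y [p pR py] gy.
exfalso; apply: gy; suff -> : act (commutator a b) y = y by [].
have gR : R (commutator a b).
  have aRw : R a by exact: rist_cat aR.
  have bRw : R b by exact: rist_cat bR.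
  by do ?[apply: subgroupM => //]; exact: subgroupV.
have [r rL [q qT qe]] := LP p pR.
have rR := LR r rL.
have [rG qG gG pG] : [/\ G r, G q, G (commutator a b) & G p].
  by split; [exact: RG|exact: triv_sub qT|exact: RG|exact: RG].
have yE : y = act q (act r e).
  rewrite -py -(actM actG) // -(rist_triv_comm rR qT) (actM actG) // qe.
  by rewrite -(actM actG) ?mulVKg //; apply: subgroupM => //; exact: subgroupV.
by rewrite yE -(actM actG) // (rist_triv_comm gR qT) (actM actG) // uP.
Qed.

(** By [generates_err] only the [R]-orbits through the finitely many errors of generators of [R]
    matter. *)
Lemma inessential_err_bound : exists2 E : set Y, finite_set E &
  deep_commutators (fun g => forall y, inessential y -> R g -> err g y -> E y \/ E (act g y)).
Proof.
have RG := @rist_sub _ G w.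
have [S' RS'] := rist_fg w.
have SG' : {subset S' <= G} by move=> s /RS'.1/RG; rewrite inE.
have /finite_seqP[L LE] := errs_finite err_finite SG'.
exists (\bigcup_(e in [set` L]) small_side e).
  by apply: bigcup_finite => [|e _]; [exact: finite_seq|exact: small_side_finite].
have [|M cM MP] := @deep_commutators_seq _ L (fun e g => inessential e ->
  forall y, orb R e y -> err g y -> small_side e y \/ small_side e (act g y)).
  move=> e eL; have [ine|nine] := pselect (inessential e).
    have [M cM MP] := inessential_orbit ine; exists M => // v.
    by have [u uP] := MP v; exists u => a b aM bM aR bR _; exact: uP.
  exists setT; last by exists [::].
  by exists bool, (fun=> true).
exists M => // v; have [u uP] := MP v; exists u => a b aM bM aR bR y iny gR gy.
have [e ye eE] := generates_err sG actG sR RG RS' gR gy.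
have eL : e \in L by move: eE; rewrite LE.
have ine : inessential e by move=> x ex; apply: iny; exact: (orb_trans actG sR RG ye).
have ey : orb R e y by exact: (orb_sym sG actG sR RG).
by have [s|s] := uP a b aM bM aR bR e eL ine y ey gy; [left|right]; exists e.
Qed.

End InessentialOrbits.

(** * Translation between errors and [nu] *)

Section Wall.
Local Open Scope group_scope.
Local Open Scope classical_set_scope.
Variables (T : groupType) (G : set T) (Y : Type) (act : T -> {classic Y} -> {classic Y}).
Variable A : set {classic Y}.
Hypotheses (sG : subgroup G) (actG : group_action G act).

Lemma err_finite_nu g : G g -> finite_set ((act g @` A) `+` A) -> finite_set (err act A g).
Proof.
move=> gG fin; apply: sub_finite_set (finite_image (act g^-1) fin) => y ne.
exists (act g y); last exact: (actK sG actG).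
have [Ay|nAy] := pselect (A y).
  left; split; first by exists y.
  by move=> Agy; apply: ne; apply/propext.
right; split; first by apply: contrapT => nA; apply: ne; apply/propext; split.
by move=> [x Ax /(act_inj sG actG gG) e]; apply: nAy; rewrite -e.
Qed.

Lemma nu_at_most n g : G g -> at_most n (err act A g) -> nu act A g <= n.
Proof.
move=> gG [s sn es].
have sub : (act g @` A) `+` A `<=` [set` map (act g) s].
  move=> z [[[x Ax <-] nA]|[Az nz]] /=.
    apply: map_f; apply: es => e; apply: nA.
    by rewrite e.
  rewrite -[z](actKV sG actG _ gG); apply: map_f; apply: es => /=.
  rewrite /err /= (actKV sG actG) // => e; apply: nz; exists (act g^-1 z).
    by rewrite -e.
  exact: (actKV sG actG).
have fin : finite_set ((act g @` A) `+` A) by apply: sub_finite_set sub _; exact: finite_seq.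
apply: leq_trans sn; rewrite /nu -(size_map (act g) s).
apply: uniq_leq_size; first exact: fset_uniq.
by move=> z; rewrite -[z \in _]/(z \in fset_set _) in_fset_set // inE => /sub.
Qed.

End Wall.

(** * Commutators of commuting products *)

Section CommutatorProduct.
Local Open Scope group_scope.
Variable X : finType.
Implicit Types g h k x y a b : tree_aut X.

Lemma commutator_mul x y a b : commute a x -> commute b x -> commute a y ->
  commute b y -> commutator (x * a) (y * b) = commutator x y * commutator a b.
Proof.
move=> ax bx ay yb.
have mul4 g h k l : commute h k -> (g * h) * (k * l) = (g * k) * (h * l).
  by move=> hk; rewrite -!mulgA; congr (_ * _); rewrite !mulgA hk.
have commMl g h k : commute g k -> commute h k -> commute (g * h) k.
  by move=> gk hk; apply/commute_sym/commuteM; exact: commute_sym.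
rewrite /commutator !invgM -(commuteV (commute_sym (commuteV ax))).
rewrite -(commuteV (commute_sym (commuteV yb))).
rewrite (mul4 x a y b) // (mul4 (x * y) (a * b) x^-1); last by apply: commuteV; apply: commMl.
rewrite (mul4 (x * y * x^-1) (a * b * a^-1) y^-1) //.
apply: commuteV; apply: (commMl); first exact: commMl.
by apply: commute_sym; apply: commuteV; exact: commute_sym.
Qed.

End CommutatorProduct.

(** * Infinitely many elements with bounded [nu] *)

Section NotPW.
Local Open Scope group_scope.
Local Open Scope classical_set_scope.
Variable X : finType.
Hypothesis hX : 1 < #|X|.
Local Notation aut := (tree_aut X).
Variables G K : set aut.
Hypotheses (sG : subgroup G) (fgG : finitely_generated G) (Gss : self_similar G).
Hypotheses (Gc : contracting G) (Gsr : self_replicating G).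
Hypotheses (sK : subgroup K) (KG : K `<=` G) (Kfi : finite_index G K).
Hypothesis KX : first_level_power K `<=` K.
Variables (Y : Type) (act : aut -> {classic Y} -> {classic Y}) (A : set {classic Y}).
Hypothesis actG : group_action G act.
Hypothesis fin : forall g, G g -> finite_set ((act g @` A) `+` A).
Implicit Types (g h k a b : aut) (u v w : seq X) (z : {classic Y}).

Lemma commutator_delta w a b : commutator (delta w a) (delta w b) = delta w (commutator a b).
Proof. by rewrite /commutator !deltaM !deltaV. Qed.

Lemma at_mostW (Z : eqType) m n (B : set Z) : m <= n -> at_most m B -> at_most n B.
Proof. by move=> mn [s sm Bs]; exists s => //; exact: leq_trans mn. Qed.

Lemma nu_not_proper : exists n, infinite_set [set g | G g /\ nu act A g <= n].
Proof.
have [S SG] := finitely_generated_generates fgG.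
have rist_fg w := rist_generates sG Gss sK KG Kfi KX w SG.
have triv_rist_fg w u : exists S', generates S' (triv G (w ++ u) `&` rist G w).
  have [S' RS'] := rist_fg w.
  apply: (triv_generates sG Gss sK KG Kfi KX (subgroup_rist w sG)) RS'.
    exact: rist_sub.
  exact: rist_cat.
have triv_fg w : exists S', generates S' (triv G w).
  have [S' TS'] := triv_generates sG Gss sK KG Kfi KX sG (fun _ => id) (@rist_sub _ G w) SG.
  exists S'; have -> : triv G w = triv G w `&` G; last by [].
  by apply/esym/setIidPl; exact: triv_sub.
have rist_inf w : infinite_set (rist G w) by exact: (rist_infinite hX sG Gsr sK KG Kfi KX).
have rist_triv_cf w := coset_finite_rist_triv sG Gss sK KG Kfi KX w.
have errf g : G g -> finite_set (err act A g).
  by move=> gG; apply: (err_finite_nu sG actG gG); exact: fin.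
have [p p0 lifts] := tame_lifts sG Gss Gsr Gc SG.
have SG' : {subset S <= G} by move=> s /SG.1; rewrite inE.
have /finite_seqP[F FE] := errs_finite errf SG'.
have /card_gt1P[x0 _] := hX.
(* Each orbit through [F] is essential at all levels or fails to be so at level [N0]. *)
have [||N0 N0P] := @seq_bound _ F (fun z n =>
    (forall m, essential G act A m z) \/ ~ essential G act A n z).
- by move=> z m n mn [|ne]; [left|right=> /(essential_antimono mn)].
- move=> z _; have [e|/existsNP[n ne]] := pselect (forall m, essential G act A m z).
    by exists 0; left.
  by exists n; right.
pose w0 := nseq N0 x0.
have [E finE [M [I [f fP]] MP]] := inessential_err_bound hX sG triv_fg rist_fg
  triv_rist_fg rist_inf rist_triv_cf actG errf w0.
have [u0 u0P] := MP [::]; pose v0 := w0 ++ u0.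
have [e0 E0] := finite_at_most finE.
have [a [b [aK bK ab]]] := branch_noncommuting hX sG Gsr sK Kfi KX.
have aVK := subgroupV sK aK; have bVK := subgroupV sK bK.
(* The sections at [v1] and [v2] of the commutators built below. They do not depend on the level, so
   one bound [C] serves all levels. *)
pose k1 := commutator a^-1 b^-1; pose k2 := commutator a b.
have comK g h : K g -> K h -> K (commutator g h).
  move=> gK hK; apply: subgroupM => //; last exact: subgroupV.
  by apply: subgroupM => //; [exact: subgroupM|exact: subgroupV].
have k1K : K k1 by exact: comK.
have k2K : K k2 by exact: comK.
have k2n : k2 <> 1.
  by move=> /divg1_eq e; apply: ab; rewrite -{2}e mulgVK.
have [||n1 n1P] := @seq_bound _ F (fun z n => (forall m, essential G act A m z) ->
    forall k, G k -> exists C, forall v g, n <= size v -> p %| size v ->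
    rist G v g -> section g v = k -> at_most C (err act A g `&` orb act G z)).
- move=> z m n mn zP zess k kG; have [C CP] := zP zess k kG; exists C => v g nv.
  by apply: CP; exact: leq_trans nv.
- move=> z _; have [e|ne] := pselect (forall m, essential G act A m z); last by exists 0.
  by have [n nP] := essential_err_bound sG SG triv_fg actG errf e FE lifts; exists n.
have [||C CP] := @seq_bound _ F (fun z C => (forall m, essential G act A m z) ->
    forall v k g, k = k1 \/ k = k2 -> n1 <= size v -> p %| size v ->
    rist G v g -> section g v = k -> at_most C (err act A g `&` orb act G z)).
- move=> z m n mn zP zess v k g kk nv pv gr gk; apply: at_mostW mn _.
  exact: zP gk.
- move=> z zF; have [e|ne] := pselect (forall m, essential G act A m z); last by exists 0.
  have [C1 C1P] := n1P z zF e k1 (KG k1K); have [C2 C2P] := n1P z zF e k2 (KG k2K).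
  exists (maxn C1 C2) => _ v k g [->|->] nv pv gr gk.
    by apply: at_mostW (C1P v g nv pv gr gk); exact: leq_maxl.
  by apply: at_mostW (C2P v g nv pv gr gk); exact: leq_maxr.
(* Per orbit: [C] errors for each of [g1] and [g2] in the essential case, the points of [E] and
   their preimages otherwise. *)
pose D := (C + C + (e0 + e0))%N.
exists (size F * D)%N; apply: infinite_aut => n.
(* The level [j * p] is a multiple of [p] and at least [n] and [n1]; below [v0] it has more words
   than there are pairs of labels in [I]. *)
pose j := (size v0 + (n + n1 + #|{: I * I}|))%N.
pose m := (j * p - size v0)%N.
have jp : j <= j * p by rewrite leq_pmulr.
have m_size : size v0 + m = (j * p)%N.
  by rewrite subnKC //; apply: leq_trans jp; exact: leq_addr.
have m_ge : n + n1 + #|{: I * I}| <= m by rewrite leq_subRL ?m_size // -m_size leq_addr.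
pose phi (u : m.-tuple X) := (f (delta (v0 ++ u) a), f (delta (v0 ++ u) b)).
(* Pigeonhole: copies of [a] at two vertices share a label, and so do those of [b]. Quotients of
   such copies, [al] and [be], therefore lie in [M]. *)
have [u1 [u2 [u12 [fa fb]]]] : exists u1 u2 : m.-tuple X, u1 <> u2 /\ phi u1 = phi u2.
  apply: contrapT => nex; have injp : injective phi.
    by move=> u1 u2 e; apply: contrapT => ne; apply: nex; exists u1, u2.
  have := leq_card _ injp; rewrite card_tuple leqNgt => /negP; apply.
  apply: leq_ltn_trans (ltn_expl m hX); apply: leq_trans m_ge; exact: leq_addl.
pose v1 := v0 ++ u1; pose v2 := v0 ++ u2.
have sv (u : m.-tuple X) : size (v0 ++ u) = (j * p)%N by rewrite size_cat size_tuple m_size.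
have v12 : v1 != v2 by apply/eqP => /catI e; apply: u12; exact: val_inj.
have r12 : rist G v1 `<=` triv G v2 by apply: rist_triv; rewrite ?sv.
have br v k : K k -> rist G v (delta v k) by exact: (branch_rist sK KG KX).
pose al := delta v1 a^-1 * delta v2 a; pose be := delta v1 b^-1 * delta v2 b.
pose g1 := delta v1 k1; pose g2 := delta v2 k2.
have com g h : K g -> K h -> commute (delta v2 g) (delta v1 h).
  by move=> gK hK; apply: rist_triv_comm (br v2 g gK) _; apply: r12; exact: br.
have gE : commutator al be = g1 * g2.
  by rewrite commutator_mul ?commutator_delta //; exact: com.
have g1r : rist G v1 g1 by exact: br.
have g2r : rist G v2 g2 by exact: br.
have [g1G g2G] : G g1 /\ G g2 by split; [exact: rist_sub g1r|exact: rist_sub g2r].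
exists (g1 * g2); split.
- split; first exact: subgroupM.
  apply: (nu_at_most sG actG (subgroupM sG g1G g2G)).
  apply: (@at_mostS _ _ _ (\bigcup_(z in [set` F]) (err act A (g1 * g2) `&` orb act G z))).
    move=> y gy; have [e ye eE] := generates_err sG actG sG (fun _ => id) SG (subgroupM sG
      g1G g2G) gy.
    exists e; first by rewrite -FE.
    by split=> //; exact: (orb_sym sG actG sG (fun _ => id)).
  apply: at_most_bigcup => z zF; have [zess|zin] := N0P z zF.
    apply: (@at_mostW _ (C + C)); first exact: leq_addr.
    have nv : n1 <= j * p.
      apply: leq_trans jp; apply: leq_trans (leq_addl _ _); rewrite -addnA addnCA.
      exact: leq_addr.
    have bnd1 := CP z zF zess v1 k1 g1 (or_introl erefl).
    have bnd2 := CP z zF zess v2 k2 g2 (or_intror erefl).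
    rewrite !sv nv dvdn_mull // in bnd1 bnd2.
    have {}bnd1 := bnd1 isT isT g1r (section_delta _ _).
    have {}bnd2 := bnd2 isT isT g2r (section_delta _ _).
    apply: at_mostS (at_mostU bnd2 (at_most_image (act g2^-1) bnd1)).
    move=> y [/(err_mul actG g1G g2G)[e|e] zy]; [by left|right].
    exists (act g2 y); last exact: (actK sG actG).
    by split=> //; apply: (orb_trans actG sG (fun _ => id) zy); exists g2.
  apply: (@at_mostW _ (e0 + e0)); first exact: leq_addl.
  apply: at_mostS (at_mostU E0 (at_most_image (act (g1 * g2)^-1) E0)).
  move=> y [gy zy].
  have iny : inessential G act A w0 y.
    move=> x yx [finx spl]; apply: zin; exists x, w0; split=> //; last by rewrite size_nseq.
    apply: (orb_trans actG sG (fun _ => id) zy).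
    by apply: (orbS _ yx); exact: rist_sub.
  have alM : M al /\ rist G v0 al.
    have a1r := br v1 a aK; have a2r := br v2 a aK.
    have r1 := @rist_cat _ G v0 u1 _ a1r; have r2 := @rist_cat _ G v0 u2 _ a2r.
    split; last by apply: subgroupM; rewrite ?deltaV;
      [exact: subgroup_rist|apply: subgroupV => //; exact: subgroup_rist|].
    rewrite /al deltaV; apply: fP => //; exact: (@rist_cat _ G w0 u0).
  have beM : M be /\ rist G v0 be.
    have b1r := br v1 b bK; have b2r := br v2 b bK.
    have r1 := @rist_cat _ G v0 u1 _ b1r; have r2 := @rist_cat _ G v0 u2 _ b2r.
    split; last by apply: subgroupM; rewrite ?deltaV;
      [exact: subgroup_rist|apply: subgroupV => //; exact: subgroup_rist|].
    rewrite /be deltaV; apply: fP => //; exact: (@rist_cat _ G w0 u0).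
  have gR : rist G w0 (g1 * g2).
    apply: subgroupM; first exact: subgroup_rist.
      by apply: (@rist_cat _ _ _ (u0 ++ u1)); rewrite catA.
    by apply: (@rist_cat _ _ _ (u0 ++ u2)); rewrite catA.
  have := u0P al be alM.1 beM.1 alM.2 beM.2 y iny; rewrite gE => /(_ gR gy)[Ey|Ey].
    by left.
  right; exists (act (g1 * g2) y) => //; apply: (actK sG actG).
  exact: subgroupM.
- move=> g12; apply: k2n; apply: (@delta_inj _ v2); rewrite delta1.
  apply: (rist_triv_1 g2r).
  have -> : g2 = g1^-1 by apply: (mulgI g1); rewrite mulgV.
  by apply: r12; apply: subgroupV => //; exact: subgroup_rist.
- move=> u un; have uj : size u <= j * p.
    apply: leq_trans un _; apply: leq_trans jp; apply: leq_trans (leq_addl _ _).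
    by rewrite -addnA leq_addr.
  by rewrite autM !delta_fix ?sv.
Qed.

End NotPW.

Theorem corollary4 (X : finType) (hX : (1 < #|X|)%N) (G : set (tree_aut X)) :
  subgroup G -> finitely_generated G -> self_similar G -> contracting G ->
  self_replicating G -> regular_branch G ->
  ~ property_PW G.
Proof.
move=> sG fgG Gss Gc Gsr [K [sK KG Kfi KX]] [Y [act [A [actG fin proper]]]].
have [n infn] := nu_not_proper hX sG fgG Gss Gc Gsr sK KG Kfi KX actG fin.
exact: infn (proper n).
Qed.
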